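(* $\mathsf{RCA}_0$ proves the implication $\mathsf{HT}^{\leq 2}_2\rightarrow\mathsf{SRT}^2_2$.
   Context: $\mathsf{RCA}_0$ is the standard base system of reverse mathematics: the subsystem of second-order arithmetic consisting of the basic axioms of arithmetic, $\Sigma^0_1$-induction, and $\Delta^0_1$-comprehension. $\mathbb{N}$ denotes the set of positive integers. For a finite nonempty $F\subseteq\mathbb{N}$, $\sum F$ denotes the sum of the elements of $F$. For $X\subseteq\mathbb{N}$ and $n\geq 1$, $\mathrm{FS}^{\leq n}(X)=\{\sum F \mid F\subseteq X \text{ and } 1\leq |F|\leq n\}$. A set $Z\subseteq\mathbb{N}$ is monochromatic for a coloring $c$ if $c(x)=c(y)$ for all $x,y\in Z$. $\mathsf{HT}^{\leq n}_k$ is the statement (of second-order arithmetic) that for every coloring $c:\mathbb{N}\to\{0,\dots,k-1\}$ there is an infinite set $X\subseteq\mathbb{N}$ such that $\mathrm{FS}^{\leq n}(X)$ is monochromatic for $c$. $\mathsf{SRT}^2_2$ (Stable Ramsey's Theorem for $2$-colorings of pairs) is the statement that for every $2$-coloring $d$ of the two-element sets of natural numbers that is stable, meaning that $\lim_s d(\{x,s\})$ exists for every $x$, there is an infinite set $H$ such that all two-element subsets of $H$ have the same color under $d$. *)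

(* Defs.v *)
From Stdlib Require Import List Arith.
Import ListNotations.

(** * The language of second-order arithmetic

    Two sorts, numbers and sets, each with its own de Bruijn indices: a number
    quantifier does not shift the set indices, nor conversely. *)

Inductive term : Type :=
| tvar (n : nat)
| tzero
| tone
| tadd (s t : term)
| tmul (s t : term).

(** Set terms are just set variables, so [fmem t X] takes an index [X].
    Equality is primitive on numbers only; sets are compared extensionally. *)
Inductive formula : Type :=
| feq (s t : term)
| flt (s t : term)
| fmem (t : term) (X : nat)
| fbot
| fimp (A B : formula)
| alln (A : formula)
| alls (A : formula).

Fixpoint tsubst (sg : nat -> term) (t : term) : term :=
  match t with
  | tvar n => sg n
  | tzero => tzero
  | tone => tone
  | tadd s t => tadd (tsubst sg s) (tsubst sg t)
  | tmul s t => tmul (tsubst sg s) (tsubst sg t)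
  end.

Definition tshift : term -> term := tsubst (fun n => tvar (S n)).

Definition scons {A : Type} (a : A) (f : nat -> A) (n : nat) : A :=
  match n with 0 => a | S n => f n end.

(** Simultaneous substitution: terms for number variables, set variables for
    set variables. *)
Fixpoint fsubst (sg : nat -> term) (rho : nat -> nat) (A : formula) : formula :=
  match A with
  | feq s t => feq (tsubst sg s) (tsubst sg t)
  | flt s t => flt (tsubst sg s) (tsubst sg t)
  | fmem t X => fmem (tsubst sg t) (rho X)
  | fbot => fbot
  | fimp A B => fimp (fsubst sg rho A) (fsubst sg rho B)
  | alln A => alln (fsubst (scons (tvar 0) (fun n => tshift (sg n))) rho A)
  | alls A => alls (fsubst sg (scons 0 (fun X => S (rho X))) A)
  end.

Definition shiftn : formula -> formula :=
  fsubst (fun n => tvar (S n)) (fun X => X).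
Definition shifts : formula -> formula := fsubst tvar S.
Definition instn (A : formula) (t : term) : formula :=
  fsubst (scons t tvar) (fun X => X) A.
Definition insts (A : formula) (X : nat) : formula :=
  fsubst tvar (scons X (fun Y => Y)) A.
(** [A(n)] becomes [A(n+1)], where [n] is the number variable [0]. *)
Definition succn (A : formula) : formula :=
  fsubst (scons (tadd (tvar 0) tone) (fun n => tvar (S n))) (fun X => X) A.

Definition fnot (A : formula) : formula := fimp A fbot.
Definition ftrue : formula := fimp fbot fbot.
Definition fand (A B : formula) : formula := fnot (fimp A (fnot B)).
Definition for_ (A B : formula) : formula := fimp (fnot A) B.
Definition fiff (A B : formula) : formula := fand (fimp A B) (fimp B A).
Definition exn (A : formula) : formula := fnot (alln (fnot A)).
Definition exs (A : formula) : formula := fnot (alls (fnot A)).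

Definition big_and (l : list formula) : formula := fold_right fand ftrue l.
Definition big_or (l : list formula) : formula := fold_right for_ fbot l.

Declare Scope so_scope.
Delimit Scope so_scope with so.
Bind Scope so_scope with term.
Bind Scope so_scope with formula.
Notation "$ n" := (tvar n) (at level 1, n at level 0, format "$ n") : so_scope.
Notation "0" := tzero : so_scope.
Notation "1" := tone : so_scope.
Infix "+" := tadd : so_scope.
Infix "*" := tmul : so_scope.
Infix "==" := feq (at level 70, no associativity) : so_scope.
Infix "<" := flt : so_scope.
Notation "t \in X" := (fmem t X) (at level 70, no associativity) : so_scope.
Infix "/\" := fand : so_scope.
Infix "\/" := for_ : so_scope.
Infix "->>" := fimp (at level 99, right associativity) : so_scope.
Infix "<<->>" := fiff (at level 95, no associativity) : so_scope.
Local Open Scope so_scope.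

(** * Classical two-sorted natural deduction

    Formulas of the theory [T] may have free variables, which are read as
    universally quantified: [prv_ax] applies under any hypotheses, and
    generalization shifts the hypotheses [G] only. *)
Inductive prv (T : formula -> Prop) : list formula -> formula -> Prop :=
| prv_ax G A : T A -> prv T G A
| prv_hyp G A : In A G -> prv T G A
| prv_impI G A B : prv T (A :: G) B -> prv T G (fimp A B)
| prv_impE G A B : prv T G (fimp A B) -> prv T G A -> prv T G B
| prv_contra G A : prv T (fnot A :: G) fbot -> prv T G A
| prv_allnI G A : prv T (map shiftn G) A -> prv T G (alln A)
| prv_allnE G A t : prv T G (alln A) -> prv T G (instn A t)
| prv_allsI G A : prv T (map shifts G) A -> prv T G (alls A)
| prv_allsE G A X : prv T G (alls A) -> prv T G (insts A X)
| prv_refl G t : prv T G (feq t t)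
| prv_eq G A s t : prv T G (feq s t) -> prv T G (instn A s) -> prv T G (instn A t).

Definition proves (T : formula -> Prop) (A : formula) : Prop := prv T [] A.

(** * RCA_0 *)

(** Bounded-quantifier formulas; the shift on the bound [t] says that the
    quantified variable does not occur in it. *)
Inductive delta0 : formula -> Prop :=
| delta0_eq s t : delta0 (feq s t)
| delta0_lt s t : delta0 (flt s t)
| delta0_mem t X : delta0 (fmem t X)
| delta0_bot : delta0 fbot
| delta0_imp A B : delta0 A -> delta0 B -> delta0 (fimp A B)
| delta0_ball t A : delta0 A -> delta0 (alln ($0 < tshift t ->> A))
| delta0_bex t A : delta0 A -> delta0 (exn ($0 < tshift t /\ A)).

Inductive sigma01 : formula -> Prop :=
| sigma01_ex A : delta0 A -> sigma01 (exn A).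

Inductive pi01 : formula -> Prop :=
| pi01_all A : delta0 A -> pi01 (alln A).

(** In induction and comprehension the distinguished variable is the number
    variable [0]; all other free variables, of both sorts, are parameters. The
    set quantified in comprehension is fresh for [A] because of [shifts]. *)
Inductive RCA0 : formula -> Prop :=
| RCA0_succ_neq0 : RCA0 (fnot ($0 + 1 == 0))
| RCA0_succ_inj : RCA0 ($0 + 1 == $1 + 1 ->> $0 == $1)
| RCA0_add0 : RCA0 ($0 + 0 == $0)
| RCA0_addS : RCA0 ($0 + ($1 + 1) == ($0 + $1) + 1)
| RCA0_mul0 : RCA0 ($0 * 0 == 0)
| RCA0_mulS : RCA0 ($0 * ($1 + 1) == ($0 * $1) + $0)
| RCA0_lt0 : RCA0 (fnot ($0 < 0))
| RCA0_ltS : RCA0 ($0 < $1 + 1 <<->> ($0 < $1 \/ $0 == $1))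
| RCA0_induction A : sigma01 A ->
    RCA0 (instn A 0 /\ alln (A ->> succn A) ->> alln A)
| RCA0_comprehension A B : sigma01 A -> pi01 B ->
    RCA0 (alln (A <<->> B) ->> exs (alln ($0 \in 0 <<->> shifts A))).

(** * Combinatorics inside second-order arithmetic

    Arguments [X], [C], [D] are indices of set variables. A finite colouring is
    a function, that is, a set of codes of pairs. *)

Fixpoint num (k : nat) : term :=
  match k with O => 0 | S k => num k + 1 end.

(** The injective pairing (i, j) |-> (i + j)^2 + i. *)
Definition pair (s t : term) : term := (s + t) * (s + t) + s.

Definition infinite (X : nat) : formula := alln (exn ($1 < $0 /\ $0 \in X)).

Definition positive (t : term) : formula := 0 < t.

(** A two-element set {x, y} with x < y is coded by the pair (x, y). *)
Definition is_pair (t : term) : formula :=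
  exn (exn ($1 < $0 /\ tshift (tshift t) == pair $1 $0)).

(** [C] is (the graph of) a function from [dom] to {0, ..., k-1}. *)
Definition coloring (dom : term -> formula) (k C : nat) : formula :=
  alln ($0 \in C ->>
        exn (exn (dom $1 /\ $0 < num k /\ $2 == pair $1 $0)))
  /\ alln (dom $0 ->> exn ($0 < num k /\ pair $1 $0 \in C))
  /\ alln (alln (alln (pair $2 $1 \in C /\ pair $2 $0 \in C ->> $1 == $0))).

(** C(s) = C(t) *)
Definition same_color (C : nat) (s t : term) : formula :=
  exn (pair (tshift s) $0 \in C /\ pair (tshift t) $0 \in C).

(** [t] is the sum of some m-element set {$0 < ... < $(m-1)} contained in [X]. *)
Definition FS_exactly (m X : nat) (t : term) : formula :=
  Nat.iter m exn
    (big_and (map (fun i => $i \in X) (seq 0 m))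
     /\ big_and (map (fun i => $i < $(S i)) (seq 0 (m - 1)))
     /\ Nat.iter m tshift t == fold_right tadd 0 (map tvar (seq 0 m))).

(** [t] is in FS^{<= n}(X). *)
Definition FS (n X : nat) (t : term) : formula :=
  big_or (map (fun m => FS_exactly m X t) (seq 1 n)).

(** HT^{<= n}_k; the colouring is set variable 0 under the first quantifier and
    1 under the second, where the solution is 0. *)
Definition HT (n k : nat) : formula :=
  alls (coloring positive k 0 ->>
    exs (alln ($0 \in 0 ->> positive $0)
         /\ infinite 0
         /\ alln (alln (FS n 0 $1 /\ FS n 0 $0 ->> same_color 1 $1 $0)))).

(** For every x there are i, m such that {x, s} has colour i for all s > m. *)
Definition stable (D : nat) : formula :=
  alln (exn (exn (alln
    ($1 < $0 /\ $3 < $0 ->> pair (pair $3 $0) $2 \in D)))).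

(** SRT^2_2, with the same indexing of set variables as in [HT]. *)
Definition SRT22 : formula :=
  alls (coloring is_pair 2 0 /\ stable 0 ->>
    exs (infinite 0
         /\ alln (alln (alln (alln
              (($3 < $2 /\ $3 \in 0 /\ $2 \in 0)
               /\ ($1 < $0 /\ $1 \in 0 /\ $0 \in 0)
               ->> same_color 1 (pair $3 $2) (pair $1 $0))))))).

(* Main.v *)
From Stdlib Require Import List Arith Lia Cantor.
From Stdlib Require Import Classical ClassicalEpsilon FunctionalExtensionality
  PropExtensionality ProofIrrelevance Ring.
Require Import Defs.
Import ListNotations.

(** The natural deduction calculus is complete for two-sorted Henkin models, so it suffices to
    argue in an arbitrary model of RCA_0.

    Given a stable colouring [d], colour [z > 0] by [d(low z, top z)], flipped when
    the lowest nonzero ternary digit of [z] is 2; here [low z] and [top z] are the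
    exponents of the lowest and of the highest nonzero ternary digit. If [x] and [y]
    agree in [low] and in the lowest digit, then passing from [y] to [x + y] flips
    that digit. In a solution [X] this forces [low] to be unbounded on [X]; and for
    [x, y] in [X] with [top x < low y] the colour of [x + y] is [d(low x, top y)] up
    to the flip, so an infinite set of numbers [low x] has the same limit colour.

    Thinning this set to a homogeneous one needs the infinite pigeonhole principle
    (that is, the collection principle for Sigma^0_2), which is again drawn from the
    principle about limit colours. Following Slaman's proof that Delta_n induction
    implies Sigma_n collection, a counterexample [f : N -> b] gives the stable colouring
    that compares the lists of colours ordered by last occurrence, coded as numbers
    below [b^b] in base [b]. *)

(** * Substitution *)

(** Base 3 is chosen for its doubling rule: twice a nonzero digit is again nonzero modulo 3 and
    differs from that digit, so adding numbers that agree in [low] and [digit] keeps [low] while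
    swapping the digits 1 and 2. In base 2 the lowest digit would cancel and [low] would move.

    The obstacle behind the second half is that only Sigma_1 induction is available. Every element
    of the infinite set has the right limit colour, but the stage from which it shows that colour is
    not computable. The elements below a bound are finite in the sense of the model only, and
    nothing yet provides a common stage for them, so a greedy thinning might get stuck. The
    pigeonhole principle supplies what is missing there.

    Inside a model the metatheory is classical and choice is free, so functions may be picked by
    description. The one discipline is definability: induction, minimization and comprehension apply
    only to predicates shown to be Sigma_1 or Delta_1, and a function may enter such a predicate
    once its graph is Sigma_1. *)

Definition upn (sg : nat -> term) : nat -> term :=
  scons (tvar 0) (fun n => tshift (sg n)).
Definition ups (rho : nat -> nat) : nat -> nat :=
  scons 0 (fun X => S (rho X)).

Lemma scons_eta {A : Type} (f : nat -> A) :
  scons (f 0) (fun n => f (S n)) = f.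
Proof. apply functional_extensionality; intros [|n]; reflexivity. Qed.

Lemma tsubst_comp sg sg' t :
  tsubst sg' (tsubst sg t) = tsubst (fun n => tsubst sg' (sg n)) t.
Proof. induction t; simpl; congruence. Qed.

Lemma tsubst_id t : tsubst tvar t = t.
Proof. induction t; simpl; congruence. Qed.

Lemma upn_comp sg sg' :
  (fun n => tsubst (upn sg') (upn sg n)) = upn (fun n => tsubst sg' (sg n)).
Proof.
  apply functional_extensionality; intros [|n]; [reflexivity|].
  simpl; unfold tshift; rewrite !tsubst_comp; reflexivity.
Qed.

Lemma ups_comp rho rho' :
  (fun X => ups rho' (ups rho X)) = ups (fun X => rho' (rho X)).
Proof. apply functional_extensionality; intros [|n]; reflexivity. Qed.

Lemma upn_id : upn tvar = tvar.
Proof. apply functional_extensionality; intros [|n]; reflexivity. Qed.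

Lemma ups_id : ups (fun X => X) = (fun X => X).
Proof. apply functional_extensionality; intros [|n]; reflexivity. Qed.

Lemma fsubst_comp A : forall sg rho sg' rho',
  fsubst sg' rho' (fsubst sg rho A)
  = fsubst (fun n => tsubst sg' (sg n)) (fun X => rho' (rho X)) A.
Proof.
  induction A; intros; simpl; rewrite ?tsubst_comp; try reflexivity.
  - rewrite IHA1, IHA2; reflexivity.
  - f_equal. fold (upn sg) (upn sg') (upn (fun n => tsubst sg' (sg n))).
    rewrite IHA, upn_comp; reflexivity.
  - f_equal. fold (ups rho) (ups rho') (ups (fun n => rho' (rho n))).
    rewrite IHA, ups_comp; reflexivity.
Qed.

Lemma fsubst_id A : fsubst tvar (fun X => X) A = A.
Proof.
  induction A; simpl; rewrite ?tsubst_id; try congruence.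
  - fold (upn tvar); rewrite upn_id; congruence.
  - fold (ups (fun X => X)); rewrite ups_id; congruence.
Qed.

Lemma fsubst_instn sg rho A t :
  fsubst sg rho (instn A t) = instn (fsubst (upn sg) rho A) (tsubst sg t).
Proof.
  unfold instn; rewrite !fsubst_comp; f_equal.
  apply functional_extensionality; intros [|n]; [reflexivity|].
  simpl; unfold tshift; rewrite tsubst_comp; simpl; symmetry; apply tsubst_id.
Qed.

Lemma fsubst_insts sg rho A X :
  fsubst sg rho (insts A X) = insts (fsubst sg (ups rho) A) (rho X).
Proof.
  unfold insts; rewrite !fsubst_comp; f_equal.
  - apply functional_extensionality; intros n; simpl; symmetry; apply tsubst_id.
  - apply functional_extensionality; intros [|n]; reflexivity.
Qed.

Lemma fsubst_shiftn sg rho A :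
  fsubst (upn sg) rho (shiftn A) = shiftn (fsubst sg rho A).
Proof. unfold shiftn; rewrite !fsubst_comp; reflexivity. Qed.

Lemma fsubst_shifts sg rho A :
  fsubst sg (ups rho) (shifts A) = shifts (fsubst sg rho A).
Proof.
  unfold shifts; rewrite !fsubst_comp; f_equal.
  apply functional_extensionality; intros n; simpl; symmetry; apply tsubst_id.
Qed.

Lemma instn_upn sg rho A t :
  instn (fsubst (upn sg) rho A) t = fsubst (scons t sg) rho A.
Proof.
  unfold instn; rewrite fsubst_comp; f_equal.
  apply functional_extensionality; intros [|n]; [reflexivity|].
  simpl; unfold tshift; rewrite tsubst_comp; apply tsubst_id.
Qed.

Lemma insts_ups sg rho A X :
  insts (fsubst sg (ups rho) A) X = fsubst sg (scons X rho) A.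
Proof.
  unfold insts; rewrite fsubst_comp; f_equal.
  - apply functional_extensionality; intros n; apply tsubst_id.
  - apply functional_extensionality; intros [|n]; reflexivity.
Qed.

(** Strict upper bounds on free indices: a substitution matters only below them, and the bound
    itself is a fresh variable. *)
Fixpoint tbound (t : term) : nat :=
  match t with
  | tvar n => S n
  | tzero | tone => 0
  | tadd s t | tmul s t => Nat.max (tbound s) (tbound t)
  end.

Fixpoint nbound (A : formula) : nat :=
  match A with
  | feq s t | flt s t => Nat.max (tbound s) (tbound t)
  | fmem t _ => tbound t
  | fbot => 0
  | fimp A B => Nat.max (nbound A) (nbound B)
  | alln A => pred (nbound A)
  | alls A => nbound A
  end.

Fixpoint sbound (A : formula) : nat :=
  match A with
  | feq _ _ | flt _ _ | fbot => 0
  | fmem _ X => S X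
  | fimp A B => Nat.max (sbound A) (sbound B)
  | alln A => sbound A
  | alls A => pred (sbound A)
  end.

Lemma tsubst_agree t : forall sg sg',
  (forall n, n < tbound t -> sg n = sg' n) -> tsubst sg t = tsubst sg' t.
Proof.
  induction t; simpl; intros sg sg' H; try reflexivity.
  - apply H; lia.
  - f_equal; [apply IHt1|apply IHt2]; intros; apply H; lia.
  - f_equal; [apply IHt1|apply IHt2]; intros; apply H; lia.
Qed.

Lemma fsubst_agree A : forall sg rho sg' rho',
  (forall n, n < nbound A -> sg n = sg' n) ->
  (forall X, X < sbound A -> rho X = rho' X) ->
  fsubst sg rho A = fsubst sg' rho' A.
Proof.
  induction A; simpl; intros sg rho sg' rho' Hn Hs.
  - f_equal; apply tsubst_agree; intros; apply Hn; lia.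
  - f_equal; apply tsubst_agree; intros; apply Hn; lia.
  - f_equal; [apply tsubst_agree; intros; apply Hn; lia | apply Hs; lia].
  - reflexivity.
  - f_equal; [apply IHA1|apply IHA2]; intros; (apply Hn || apply Hs); lia.
  - f_equal; apply IHA; intros; [|apply Hs; lia].
    destruct n; [reflexivity|]. simpl. rewrite Hn; [reflexivity|lia].
  - f_equal; apply IHA; intros; [apply Hn; lia|].
    destruct X; [reflexivity|]. simpl. rewrite Hs; [reflexivity|lia].
Qed.

(** * Structural rules *)

Section Calculus.
Variable T : formula -> Prop.

Lemma prv_weaken G A : prv T G A -> forall G', incl G G' -> prv T G' A.
Proof.
  induction 1; intros G' HG.
  - apply prv_ax; assumption.
  - apply prv_hyp; auto.
  - apply prv_impI, IHprv; intros x [->|]; [left|right]; auto.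
  - eapply prv_impE; eauto.
  - apply prv_contra, IHprv; intros x [->|]; [left|right]; auto.
  - apply prv_allnI, IHprv, incl_map, HG.
  - apply prv_allnE; auto.
  - apply prv_allsI, IHprv, incl_map, HG.
  - apply prv_allsE; auto.
  - apply prv_refl.
  - eapply prv_eq; eauto.
Qed.

(** The calculus has no substitution rule. Generalizing and instantiating [N] times replaces the
    variables one after another, which the empty context permits. *)
Lemma prv_subst_term A : forall N sg, prv T [] A ->
  prv T [] (fsubst (fun n => if n <? N then sg n else tvar (n - N)) (fun X => X) A).
Proof.
  intros N; revert A; induction N; intros A sg HA.
  - replace (fsubst _ _ A) with A; [assumption|].
    rewrite <- (fsubst_id A) at 1. f_equal.
    apply functional_extensionality; intros n; simpl.
    rewrite Nat.sub_0_r; reflexivity.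
  - pose (t := tsubst (fun n => tvar (n + N)) (sg 0)).
    assert (HB : prv T [] (instn A t)) by (apply prv_allnE, prv_allnI, HA).
    specialize (IHN _ (fun n => sg (S n)) HB).
    unfold instn in IHN; rewrite fsubst_comp in IHN.
    replace (fun n => if n <? S N then sg n else tvar (n - S N))
      with (fun n => tsubst (fun n => if n <? N then sg (S n) else tvar (n - N))
                       (scons t tvar n)); [exact IHN|].
    apply functional_extensionality; intros [|n]; simpl; [|reflexivity].
    unfold t; rewrite tsubst_comp; transitivity (tsubst tvar (sg 0));
      [|apply tsubst_id].
    f_equal; apply functional_extensionality; intros n; simpl.
    destruct (Nat.ltb_spec (n + N) N); [lia|]. f_equal; lia.
Qed.

Lemma prv_subst_set A : forall N rho, prv T [] A ->
  prv T [] (fsubst tvar (fun X => if X <? N then rho X else X - N) A).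
Proof.
  intros N; revert A; induction N; intros A rho HA.
  - replace (fsubst _ _ A) with A; [assumption|].
    rewrite <- (fsubst_id A) at 1. f_equal.
    apply functional_extensionality; intros n; simpl.
    rewrite Nat.sub_0_r; reflexivity.
  - assert (HB : prv T [] (insts A (rho 0 + N))) by (apply prv_allsE, prv_allsI, HA).
    specialize (IHN _ (fun n => rho (S n)) HB).
    unfold insts in IHN; rewrite fsubst_comp in IHN.
    replace (fun X => if X <? S N then rho X else X - S N)
      with (fun X => (fun X => if X <? N then rho (S X) else X - N)
                       (scons (rho 0 + N) (fun Y => Y) X)); [exact IHN|].
    apply functional_extensionality; intros [|n]; simpl; [|reflexivity].
    destruct (Nat.ltb_spec (rho 0 + N) N); lia.
Qed.

Lemma prv_closed_subst A sg rho : prv T [] A -> prv T [] (fsubst sg rho A).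
Proof.
  intros HA.
  apply (prv_subst_term _ (nbound A) sg) in HA.
  apply (prv_subst_set _ (sbound A) rho) in HA.
  rewrite fsubst_comp in HA.
  erewrite fsubst_agree; [exact HA| |]; simpl; intros k Hk;
    destruct (Nat.ltb_spec k (nbound A)), (Nat.ltb_spec k (sbound A));
    try lia; rewrite ?tsubst_id; reflexivity.
Qed.

(** [T] is not assumed closed under substitution; an axiom is handled by [prv_closed_subst], because
    its free variables can be generalized in the empty context. *)
Lemma prv_subst G A : prv T G A -> forall sg rho,
  prv T (map (fsubst sg rho) G) (fsubst sg rho A).
Proof.
  induction 1; intros sg rho.
  - apply (prv_weaken []); [|intros x []].
    apply prv_closed_subst, prv_ax; assumption.
  - apply prv_hyp, in_map; assumption.
  - simpl; apply prv_impI, IHprv.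
  - eapply prv_impE; [apply IHprv1|apply IHprv2].
  - apply prv_contra, IHprv.
  - simpl; apply prv_allnI.
    specialize (IHprv (upn sg) rho). rewrite map_map in *.
    erewrite map_ext; [exact IHprv|]. intros; symmetry; apply fsubst_shiftn.
  - rewrite fsubst_instn; apply prv_allnE, IHprv.
  - simpl; apply prv_allsI.
    specialize (IHprv sg (ups rho)). rewrite map_map in *.
    erewrite map_ext; [exact IHprv|]. intros; symmetry; apply fsubst_shifts.
  - rewrite fsubst_insts; apply prv_allsE, IHprv.
  - simpl; apply prv_refl.
  - rewrite fsubst_instn. apply prv_eq with (s := tsubst sg s); [apply IHprv1|].
    rewrite <- fsubst_instn; apply IHprv2.
Qed.

(** Generalization over a named fresh variable: renaming [k] to 0 and raising all other variables
    yields the premise of [prv_allnI]. Henkin witnesses will be variables of this kind instead of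
    new constants. *)
Lemma prv_gen_var G A k :
  (forall B, In B G -> nbound B <= k) -> nbound A <= S k ->
  prv T G (instn A (tvar k)) -> prv T G (alln A).
Proof.
  intros HG HA H. apply prv_allnI.
  pose (sg := fun n => if n =? k then tvar 0 else tvar (S n)).
  apply (prv_subst _ _) with (sg := sg) (rho := fun X => X) in H.
  replace (fsubst sg (fun X => X) (instn A (tvar k))) with A in H.
  - erewrite map_ext_in; [exact H|]. intros B HB; simpl.
    apply fsubst_agree; [|reflexivity]. intros n Hn; unfold sg.
    specialize (HG B HB). destruct (Nat.eqb_spec n k); [lia|reflexivity].
  - rewrite fsubst_instn, instn_upn. rewrite <- (fsubst_id A) at 1.
    apply fsubst_agree; [|reflexivity].
    intros [|n] Hn; simpl; unfold sg.
    + rewrite Nat.eqb_refl; reflexivity.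
    + destruct (Nat.eqb_spec n k); [lia|reflexivity].
Qed.

Lemma prv_gen_set_var G A k :
  (forall B, In B G -> sbound B <= k) -> sbound A <= S k ->
  prv T G (insts A k) -> prv T G (alls A).
Proof.
  intros HG HA H. apply prv_allsI.
  pose (rho := fun X => if X =? k then 0 else S X).
  apply (prv_subst _ _) with (sg := tvar) (rho := rho) in H.
  replace (fsubst tvar rho (insts A k)) with A in H.
  - erewrite map_ext_in; [exact H|]. intros B HB; simpl.
    apply fsubst_agree; [reflexivity|]. intros n Hn; unfold rho.
    specialize (HG B HB). destruct (Nat.eqb_spec n k); [lia|reflexivity].
  - rewrite fsubst_insts, insts_ups. rewrite <- (fsubst_id A) at 1.
    apply fsubst_agree; [reflexivity|].
    intros [|n] Hn; simpl; unfold rho.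
    + rewrite Nat.eqb_refl; reflexivity.
    + destruct (Nat.eqb_spec n k); [lia|reflexivity].
Qed.

Lemma prv_cut G A B : prv T G A -> prv T (A :: G) B -> prv T G B.
Proof. intros HA HB; exact (prv_impE _ _ _ _ (prv_impI _ _ _ _ HB) HA). Qed.

Lemma prv_fbot_elim G A : prv T G fbot -> prv T G A.
Proof.
  intros H; apply prv_contra, (prv_weaken _ _ H); intros x Hx; right; exact Hx.
Qed.

(** * Henkin extensions *)

Definition consistent (G : list formula) : Prop := ~ prv T G fbot.

Fixpoint term_code (t : term) : nat :=
  match t with
  | tvar n => to_nat (0, n)
  | tzero => to_nat (1, 0)
  | tone => to_nat (2, 0)
  | tadd s t => to_nat (3, to_nat (term_code s, term_code t))
  | tmul s t => to_nat (4, to_nat (term_code s, term_code t))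
  end.

Fixpoint formula_code (A : formula) : nat :=
  match A with
  | feq s t => to_nat (0, to_nat (term_code s, term_code t))
  | flt s t => to_nat (1, to_nat (term_code s, term_code t))
  | fmem t X => to_nat (2, to_nat (term_code t, X))
  | fbot => to_nat (3, 0)
  | fimp A B => to_nat (4, to_nat (formula_code A, formula_code B))
  | alln A => to_nat (5, formula_code A)
  | alls A => to_nat (6, formula_code A)
  end.

Ltac code_inj :=
  repeat match goal with
  | H : to_nat _ = to_nat _ |- _ =>
    apply to_nat_inj, pair_equal_spec in H; destruct H as [? H]
  end.

Lemma term_code_inj s t : term_code s = term_code t -> s = t.
Proof.
  revert t; induction s; intros [] H; cbn [term_code] in H;
    code_inj; try discriminate; subst; f_equal; auto.
Qed.

Lemma formula_code_inj A B : formula_code A = formula_code B -> A = B.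
Proof.
  revert B; induction A; intros [] H; cbn [formula_code] in H;
    code_inj; try discriminate; subst; f_equal; auto using term_code_inj.
Qed.

Definition fresh (bound : formula -> nat) (G : list formula) : nat :=
  list_max (map bound G).

Lemma fresh_spec bound G B : In B G -> bound B <= fresh bound G.
Proof.
  intros HB.
  assert (H : list_max (map bound G) <= fresh bound G) by reflexivity.
  apply list_max_le in H. rewrite Forall_forall in H. apply H, in_map, HB.
Qed.

(** A universal formula that is rejected leaves a counterexample at a variable fresh for the stage.
    Each stage is a finite list, so such a variable always exists. *)
Definition henkin_step (G : list formula) (A : formula) : list formula :=
  if excluded_middle_informative (consistent (A :: G)) then A :: G
  else match A with
  | alln B => fnot (instn B (tvar (fresh nbound (A :: G)))) :: G
  | alls B => fnot (insts B (fresh sbound (A :: G))) :: G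
  | _ => G
  end.

Lemma henkin_step_incl G A : incl G (henkin_step G A).
Proof.
  unfold henkin_step; destruct excluded_middle_informative;
    [|destruct A]; intros x Hx; auto; right; auto.
Qed.

(** If the new counterexample were inconsistent with [G], the instance at the fresh variable would
    be provable, hence the universal formula too, and that formula had been found inconsistent with
    [G]. *)
Lemma henkin_step_consistent G A : consistent G -> consistent (henkin_step G A).
Proof.
  intros HG; unfold henkin_step.
  destruct excluded_middle_informative as [H|H]; [assumption|].
  destruct A as [| | | | |B|B]; try assumption; apply NNPP in H;
    intros H'; apply prv_contra in H'; apply HG; eapply prv_cut; try exact H.
  - eapply prv_gen_var; [| |exact H'].
    + intros C HC; apply fresh_spec; right; exact HC.
    + assert (K := fresh_spec nbound (alln B :: G) (alln B) (or_introl eq_refl)).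
      simpl nbound in K at 1. lia.
  - eapply prv_gen_set_var; [| |exact H'].
    + intros C HC; apply fresh_spec; right; exact HC.
    + assert (K := fresh_spec sbound (alls B :: G) (alls B) (or_introl eq_refl)).
      simpl sbound in K at 1. lia.
Qed.

Variable G0 : list formula.
Hypothesis G0_consistent : consistent G0.

Fixpoint henkin (n : nat) : list formula :=
  match n with
  | 0 => G0
  | S n =>
    match excluded_middle_informative (exists A, formula_code A = n) with
    | left H => henkin_step (henkin n) (proj1_sig (constructive_indefinite_description _ H))
    | right _ => henkin n
    end
  end.

Lemma henkin_code A : henkin (S (formula_code A)) = henkin_step (henkin (formula_code A)) A.
Proof.
  simpl; destruct excluded_middle_informative as [H|H].
  - destruct constructive_indefinite_description as [B HB]; simpl.
    apply formula_code_inj in HB; subst; reflexivity.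
  - destruct H; exists A; reflexivity.
Qed.

Lemma henkin_consistent n : consistent (henkin n).
Proof.
  induction n; simpl; [assumption|].
  destruct excluded_middle_informative; auto using henkin_step_consistent.
Qed.

Lemma henkin_mono n m : n <= m -> incl (henkin n) (henkin m).
Proof.
  induction 1; [apply incl_refl|]. eapply incl_tran; [exact IHle|].
  simpl; destruct excluded_middle_informative;
    [apply henkin_step_incl|apply incl_refl].
Qed.

Definition val (A : formula) : Prop := exists n, prv T (henkin n) A.

Lemma val_closed l A : (forall B, In B l -> val B) -> prv T l A -> val A.
Proof.
  revert A; induction l as [|B l IH]; intros A Hl HA.
  - exists 0. apply (prv_weaken [] _ HA); intros x [].
  - destruct (IH (fimp B A)) as [n Hn].
    + intros C HC; apply Hl; right; exact HC.
    + apply prv_impI, HA.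
    + destruct (Hl B) as [m Hm]; [left; reflexivity|].
      exists (Nat.max n m). eapply prv_impE.
      * apply (prv_weaken _ _ Hn), henkin_mono; lia.
      * apply (prv_weaken _ _ Hm), henkin_mono; lia.
Qed.

Lemma val_bot : ~ val fbot.
Proof. intros [n Hn]; exact (henkin_consistent n Hn). Qed.

(** The stage whose number is the code of [A] either accepts [A] or already proves its negation. *)
Lemma val_complete A : val A \/ val (fnot A).
Proof.
  pose (n := formula_code A).
  destruct (classic (consistent (A :: henkin n))) as [H|H].
  - left; exists (S n). unfold n; rewrite henkin_code; unfold henkin_step.
    destruct excluded_middle_informative; [|contradiction].
    apply prv_hyp; left; reflexivity.
  - right; exists n. apply prv_impI, NNPP, H.
Qed.

Lemma val_imp A B : val (fimp A B) <-> (val A -> val B).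
Proof.
  split.
  - intros HAB HA. apply (val_closed [fimp A B; A]).
    + intros C [<-|[<-|[]]]; assumption.
    + apply prv_impE with A; apply prv_hyp; simpl; auto.
  - intros H. destruct (val_complete A) as [HA|HA].
    + apply (val_closed [B]); [intros C [<-|[]]; auto|].
      apply prv_impI, prv_hyp; simpl; auto.
    + apply (val_closed [fnot A]); [intros C [<-|[]]; auto|].
      apply prv_impI, prv_fbot_elim, prv_impE with A; apply prv_hyp; simpl; auto.
Qed.

Lemma val_not A : val (fnot A) <-> ~ val A.
Proof.
  unfold fnot; rewrite val_imp. split; intros H K; [exact (val_bot (H K))|].
  contradiction.
Qed.

Lemma val_alln A : val (alln A) <-> forall t, val (instn A t).
Proof.
  split.
  - intros H t. apply (val_closed [alln A]); [intros C [<-|[]]; auto|].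
    apply prv_allnE, prv_hyp; left; reflexivity.
  - intros H. apply NNPP; intros HA. set (n := formula_code (alln A)).
    destruct (classic (consistent (alln A :: henkin n))) as [K|K].
    + apply HA; exists (S n). unfold n; rewrite henkin_code; unfold henkin_step.
      destruct excluded_middle_informative; [|contradiction].
      apply prv_hyp; left; reflexivity.
    + assert (E : henkin (S n) = fnot (instn A (tvar (fresh nbound (alln A :: henkin n)))) :: henkin n).
      { unfold n at 1; rewrite henkin_code; unfold henkin_step.
        destruct excluded_middle_informative; [contradiction|reflexivity]. }
      specialize (H (tvar (fresh nbound (alln A :: henkin n)))).
      revert H; apply val_not; exists (S n). rewrite E.
      apply prv_hyp; left; reflexivity.
Qed.

Lemma val_alls A : val (alls A) <-> forall X, val (insts A X).
Proof.
  split.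
  - intros H X. apply (val_closed [alls A]); [intros C [<-|[]]; auto|].
    apply prv_allsE, prv_hyp; left; reflexivity.
  - intros H. apply NNPP; intros HA. set (n := formula_code (alls A)).
    destruct (classic (consistent (alls A :: henkin n))) as [K|K].
    + apply HA; exists (S n). unfold n; rewrite henkin_code; unfold henkin_step.
      destruct excluded_middle_informative; [|contradiction].
      apply prv_hyp; left; reflexivity.
    + assert (E : henkin (S n) = fnot (insts A (fresh sbound (alls A :: henkin n))) :: henkin n).
      { unfold n at 1; rewrite henkin_code; unfold henkin_step.
        destruct excluded_middle_informative; [contradiction|reflexivity]. }
      specialize (H (fresh sbound (alls A :: henkin n))).
      revert H; apply val_not; exists (S n). rewrite E.
      apply prv_hyp; left; reflexivity.
Qed.

Lemma val_eq_subst A s t : val (feq s t) -> val (instn A s) -> val (instn A t).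
Proof.
  intros Hst Hs. apply (val_closed [feq s t; instn A s]).
  - intros C [<-|[<-|[]]]; assumption.
  - apply prv_eq with s; apply prv_hyp; simpl; auto.
Qed.

Lemma val_refl t : val (feq t t).
Proof. exists 0; apply prv_refl. Qed.

Lemma instn_feq_tshift s u t : instn (feq s (tshift u)) t = feq (tsubst (scons t tvar) s) u.
Proof.
  unfold instn; simpl; f_equal. unfold tshift; rewrite tsubst_comp; apply tsubst_id.
Qed.

Lemma val_sym s t : val (feq s t) -> val (feq t s).
Proof.
  intros H. assert (K := val_eq_subst (feq (tvar 0) (tshift s)) s t H).
  rewrite !instn_feq_tshift in K. apply K, val_refl.
Qed.

Lemma val_trans s t u : val (feq s t) -> val (feq t u) -> val (feq s u).
Proof.
  intros H1 H2. assert (K := val_eq_subst (feq (tvar 0) (tshift u)) t s (val_sym _ _ H1)).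
  rewrite !instn_feq_tshift in K. apply K, H2.
Qed.

End Calculus.

(** * Models and completeness *)

Record structure : Type := Structure {
  dom : Type;
  set_dom : Type;
  s_zero : dom;
  s_one : dom;
  s_add : dom -> dom -> dom;
  s_mul : dom -> dom -> dom;
  s_lt : dom -> dom -> Prop;
  s_mem : dom -> set_dom -> Prop }.

Fixpoint teval (M : structure) (e : nat -> dom M) (t : term) : dom M :=
  match t with
  | tvar n => e n
  | tzero => s_zero M
  | tone => s_one M
  | tadd s t => s_add M (teval M e s) (teval M e t)
  | tmul s t => s_mul M (teval M e s) (teval M e t)
  end.

Fixpoint sat (M : structure) (e : nat -> dom M) (E : nat -> set_dom M) (A : formula) : Prop :=
  match A with
  | feq s t => teval M e s = teval M e t
  | flt s t => s_lt M (teval M e s) (teval M e t)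
  | fmem t X => s_mem M (teval M e t) (E X)
  | fbot => False
  | fimp A B => sat M e E A -> sat M e E B
  | alln A => forall x, sat M (scons x e) E A
  | alls A => forall X, sat M e (scons X E) A
  end.

Definition models (M : structure) (T : formula -> Prop) : Prop :=
  forall A e E, T A -> sat M e E A.

Section TermModel.
Variable T : formula -> Prop.
Variable G0 : list formula.
Hypothesis G0_consistent : consistent T G0.

Notation V := (val T G0).

(** The quotient of the terms by provable equality, a class being its characteristic predicate. Sets
    need no quotient, since the language has no equality between them. *)
Definition tclass : Type :=
  {P : term -> Prop | exists t, P = fun s => V (feq t s)}.

Definition cls (t : term) : tclass :=
  exist _ (fun s => V (feq t s)) (ex_intro _ t eq_refl).

Lemma cls_eq s t : cls s = cls t <-> V (feq s t).
Proof.
  split.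
  - intros H. injection H as H. apply (f_equal (fun P => P t)) in H.
    rewrite H. apply val_refl.
  - intros H. apply subset_eq_compat. apply functional_extensionality; intros u.
    apply propositional_extensionality; split; intros K.
    + eapply val_trans; [apply val_sym; exact H|exact K].
    + eapply val_trans; eassumption.
Qed.

Lemma cls_surj (d : tclass) : exists t, cls t = d.
Proof.
  destruct d as [P [t Ht]]. exists t. apply subset_eq_compat. symmetry; exact Ht.
Qed.

Definition rep (d : tclass) : term :=
  proj1_sig (constructive_indefinite_description _ (cls_surj d)).

Lemma cls_rep d : cls (rep d) = d.
Proof. exact (proj2_sig (constructive_indefinite_description _ (cls_surj d))). Qed.

Lemma val_rep t : V (feq (rep (cls t)) t).
Proof. apply cls_eq, cls_rep. Qed.

Definition term_model : structure := {|
  dom := tclass;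
  set_dom := nat;
  s_zero := cls tzero;
  s_one := cls tone;
  s_add c d := cls (tadd (rep c) (rep d));
  s_mul c d := cls (tmul (rep c) (rep d));
  s_lt c d := V (flt (rep c) (rep d));
  s_mem c X := V (fmem (rep c) X) |}.

Lemma instn_tshift s t : tsubst (scons t tvar) (tshift s) = s.
Proof. unfold tshift; rewrite tsubst_comp; apply tsubst_id. Qed.

Lemma val_congr (op : term -> term -> term) s s' t t' :
  (forall sg a b, tsubst sg (op a b) = op (tsubst sg a) (tsubst sg b)) ->
  V (feq s s') -> V (feq t t') -> V (feq (op s t) (op s' t')).
Proof.
  intros Hop Hs Ht. apply val_trans with (op s' t).
  - assert (K := val_eq_subst T G0 (feq (op (tvar 0) (tshift t)) (tshift (op s' t))) s' s
                   (val_sym _ _ _ _ Hs)).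
    rewrite !instn_feq_tshift, !Hop, !instn_tshift in K.
    apply K, val_refl.
  - assert (K := val_eq_subst T G0 (feq (op (tshift s') (tvar 0)) (tshift (op s' t'))) t' t
                   (val_sym _ _ _ _ Ht)).
    rewrite !instn_feq_tshift, !Hop, !instn_tshift in K.
    apply K, val_refl.
Qed.

Lemma val_lt_congr s s' t t' :
  V (feq s s') -> V (feq t t') -> V (flt s t) -> V (flt s' t').
Proof.
  intros Hs Ht H.
  assert (K := val_eq_subst T G0 (flt (tvar 0) (tshift t)) s s' Hs).
  unfold instn in K; simpl in K; rewrite !instn_tshift in K.
  assert (K' := val_eq_subst T G0 (flt (tshift s') (tvar 0)) t t' Ht).
  unfold instn in K'; simpl in K'; rewrite !instn_tshift in K'. auto.
Qed.

Lemma val_mem_congr s s' X : V (feq s s') -> V (fmem s X) -> V (fmem s' X).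
Proof. exact (val_eq_subst T G0 (fmem (tvar 0) X) s s'). Qed.

Lemma teval_term_model sg t :
  teval term_model (fun n => cls (sg n)) t = cls (tsubst sg t).
Proof.
  induction t; simpl; try reflexivity; rewrite IHt1, IHt2; apply cls_eq;
    apply val_congr; auto using val_rep; reflexivity.
Qed.

Lemma scons_map {A B : Type} (f : A -> B) (a : A) (g : nat -> A) :
  scons (f a) (fun n => f (g n)) = fun n => f (scons a g n).
Proof. apply functional_extensionality; intros [|n]; reflexivity. Qed.

(** Every element of the model is the class of a term, so a number quantifier ranges over exactly
    the instances that [val_alln] speaks of; likewise for set variables and [val_alls]. *)
Lemma truth_lemma A : forall sg rho,
  sat term_model (fun n => cls (sg n)) rho A <-> V (fsubst sg rho A).
Proof.
  induction A; intros sg rho; cbn [sat fsubst].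
  - rewrite !teval_term_model; apply cls_eq.
  - rewrite !teval_term_model; simpl; split; apply val_lt_congr;
      auto using val_rep, val_sym.
  - rewrite teval_term_model; simpl; split; apply val_mem_congr;
      auto using val_rep, val_sym.
  - split; [contradiction|]. intros H; exact (val_bot _ _ G0_consistent H).
  - rewrite val_imp, IHA1, IHA2 by assumption; reflexivity.
  - fold (upn sg). rewrite val_alln by assumption. split.
    + intros H t. rewrite instn_upn. apply IHA. rewrite <- scons_map. apply H.
    + intros H d. destruct (cls_surj d) as [t <-]. rewrite scons_map.
      apply IHA. rewrite <- instn_upn; apply H.
  - fold (ups rho). rewrite val_alls by assumption. split.
    + intros H X. rewrite insts_ups. apply IHA, H.
    + intros H X. apply IHA. rewrite <- insts_ups; apply H.
Qed.

Lemma term_model_models : models term_model T.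
Proof.
  intros A e E HA.
  replace e with (fun n => cls (rep (e n)))
    by (apply functional_extensionality; intros; apply cls_rep).
  apply truth_lemma. exists 0. apply (prv_weaken T []); [|intros x []].
  apply prv_closed_subst, prv_ax, HA.
Qed.

End TermModel.

(** If [A] has no proof, then [[fnot A]] is consistent, and its term model refutes [A] under the
    assignment that sends each variable to itself. *)
Theorem completeness T A :
  (forall M e E, models M T -> sat M e E A) -> proves T A.
Proof.
  intros H. apply prv_contra, NNPP; intros HA.
  assert (K := H (term_model T [fnot A]) (fun n => cls T [fnot A] (tvar n))
                 (fun X => X) (term_model_models T _ HA)).
  apply truth_lemma in K; [|exact HA]. rewrite fsubst_id in K.
  apply (val_bot T [fnot A] HA).
  assert (N : val T [fnot A] (fnot A)) by (exists 0; apply prv_hyp; left; reflexivity).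
  apply (val_not T [fnot A] HA A) in N. contradiction.
Qed.

(** * Definability in a model *)

Lemma teval_subst M e sg t :
  teval M e (tsubst sg t) = teval M (fun n => teval M e (sg n)) t.
Proof. induction t; simpl; congruence. Qed.

Lemma forall_eq {X : Type} (P Q : X -> Prop) :
  (forall x, P x = Q x) -> (forall x, P x) = (forall x, Q x).
Proof.
  intros H. apply propositional_extensionality.
  split; intros K x; [rewrite <- H|rewrite H]; apply K.
Qed.

(** An equality of propositions rather than an equivalence, so that it can be used for rewriting at
    any place; this is where propositional extensionality enters. *)
Lemma sat_subst M A : forall e E sg rho,
  sat M e E (fsubst sg rho A)
  = sat M (fun n => teval M e (sg n)) (fun X => E (rho X)) A.
Proof.
  induction A; intros e E sg rho; cbn [sat fsubst]; rewrite ?teval_subst;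
    try reflexivity.
  - rewrite IHA1, IHA2; reflexivity.
  - apply forall_eq; intros x. rewrite IHA. f_equal.
    apply functional_extensionality; intros [|n]; [reflexivity|].
    simpl; unfold tshift; apply teval_subst.
  - apply forall_eq; intros X. rewrite IHA. f_equal.
    apply functional_extensionality; intros [|n]; reflexivity.
Qed.

Section Connectives.
Variables (M : structure) (e : nat -> dom M) (E : nat -> set_dom M).

Lemma sat_and A B : sat M e E (fand A B) <-> sat M e E A /\ sat M e E B.
Proof. cbn; tauto. Qed.

Lemma sat_or A B : sat M e E (for_ A B) <-> sat M e E A \/ sat M e E B.
Proof. cbn; tauto. Qed.

Lemma sat_iff A B : sat M e E (fiff A B) <-> (sat M e E A <-> sat M e E B).
Proof. unfold fiff; rewrite sat_and; cbn; tauto. Qed.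

Lemma sat_exn A : sat M e E (exn A) <-> exists x, sat M (scons x e) E A.
Proof.
  cbn; split; [|intros [x Hx] H; exact (H x Hx)].
  intros H; apply NNPP; intros K; apply H; intros x Hx; apply K; exists x; exact Hx.
Qed.

Lemma sat_exs A : sat M e E (exs A) <-> exists X, sat M e (scons X E) A.
Proof.
  cbn; split; [|intros [x Hx] H; exact (H x Hx)].
  intros H; apply NNPP; intros K; apply H; intros x Hx; apply K; exists x; exact Hx.
Qed.
End Connectives.

Lemma tshift_subst sg t : tsubst (upn sg) (tshift t) = tshift (tsubst sg t).
Proof. unfold tshift; rewrite !tsubst_comp; reflexivity. Qed.

Lemma delta0_subst A : delta0 A -> forall sg rho, delta0 (fsubst sg rho A).
Proof.
  induction 1; intros sg rho; cbn; try (constructor; auto; fail).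
  - fold (upn sg); rewrite tshift_subst; constructor; apply IHdelta0.
  - fold (upn sg); rewrite tshift_subst; apply delta0_bex; apply IHdelta0.
Qed.

(** The set [some_set] is a default value for set assignments, as a structure may have no sets at
    all. *)
Class RCA0_model : Type := {
  model : structure;
  model_axioms : models model RCA0;
  some_set : set_dom model }.

Declare Scope model_scope.
Delimit Scope model_scope with M.
Notation num := (dom model).
Notation "0" := (s_zero model) : model_scope.
Notation "1" := (s_one model) : model_scope.
Infix "+" := (s_add model) : model_scope.
Infix "*" := (s_mul model) : model_scope.
Infix "<" := (s_lt model) : model_scope.
Notation "x 'in_set' X" := (s_mem model x X) (at level 70) : model_scope.
Bind Scope model_scope with dom.

Section Definability.
Context {K : RCA0_model}.
Open Scope model_scope.

Notation env := (nat -> num).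

(** An assignment of the free variables of a formula by arguments ([inl]) and
    constants of the model ([inr]). *)
Definition assignment : Type := nat -> nat + num.

Definition assign (phi : assignment) (e : env) : env :=
  fun n => match phi n with inl m => e m | inr a => a end.

Definition D0 (P : env -> Prop) : Prop :=
  exists A phi E, delta0 A /\ forall e, P e <-> sat model (assign phi e) E A.

Definition T0 (f : env -> num) : Prop :=
  exists t phi, forall e, f e = teval model (assign phi e) t.

(** Two formulas with their own parameters are combined into one by moving the variables of the
    first to even and those of the second to odd indices. *)
Definition merge {X : Type} (f g : nat -> X) (n : nat) : X :=
  if Nat.even n then f (Nat.div2 n) else g (Nat.div2 n).

Definition dbl (n : nat) := (2 * n)%nat.
Definition dbl1 (n : nat) := S (2 * n).

Lemma merge_even {X} (f g : nat -> X) n : merge f g (dbl n) = f n.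
Proof.
  unfold merge, dbl. rewrite Nat.even_even, Nat.div2_double; reflexivity.
Qed.

Lemma merge_odd {X} (f g : nat -> X) n : merge f g (dbl1 n) = g n.
Proof.
  unfold merge, dbl1. rewrite Nat.even_succ, Nat.odd_even, Nat.div2_succ_double; reflexivity.
Qed.

Lemma assign_merge_even phi psi e n :
  assign (merge phi psi) e (dbl n) = assign phi e n.
Proof. unfold assign; rewrite merge_even; reflexivity. Qed.

Lemma assign_merge_odd phi psi e n :
  assign (merge phi psi) e (dbl1 n) = assign psi e n.
Proof. unfold assign; rewrite merge_odd; reflexivity. Qed.

Definition renv (r : nat -> nat) : nat -> term := fun n => tvar (r n).

Lemma teval_merge_even phi psi e t :
  teval model (assign (merge phi psi) e) (tsubst (renv dbl) t) = teval model (assign phi e) t.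
Proof.
  rewrite teval_subst; f_equal; apply functional_extensionality; intros n.
  apply assign_merge_even.
Qed.

Lemma teval_merge_odd phi psi e t :
  teval model (assign (merge phi psi) e) (tsubst (renv dbl1) t) = teval model (assign psi e) t.
Proof.
  rewrite teval_subst; f_equal; apply functional_extensionality; intros n.
  apply assign_merge_odd.
Qed.

Lemma sat_merge_even phi psi e E F A :
  sat model (assign (merge phi psi) e) (merge E F) (fsubst (renv dbl) dbl A)
  = sat model (assign phi e) E A.
Proof.
  rewrite sat_subst; f_equal; apply functional_extensionality; intros n.
  - apply assign_merge_even.
  - apply merge_even.
Qed.

Lemma sat_merge_odd phi psi e E F A :
  sat model (assign (merge phi psi) e) (merge E F) (fsubst (renv dbl1) dbl1 A)
  = sat model (assign psi e) F A.
Proof.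
  rewrite sat_subst; f_equal; apply functional_extensionality; intros n.
  - apply assign_merge_odd.
  - apply merge_odd.
Qed.

Lemma D0_ext P Q : D0 P -> (forall e, Q e <-> P e) -> D0 Q.
Proof.
  intros [A [phi [E [HA HP]]]] H. exists A, phi, E; split; [assumption|].
  intros e; rewrite H; apply HP.
Qed.

Lemma T0_var n : T0 (fun e => e n).
Proof. exists (tvar 0), (fun _ => inl n); reflexivity. Qed.

Lemma T0_const a : T0 (fun _ => a).
Proof. exists (tvar 0), (fun _ => inr a); reflexivity. Qed.

Lemma T0_add f g : T0 f -> T0 g -> T0 (fun e => f e + g e).
Proof.
  intros [s [phi Hs]] [t [psi Ht]].
  exists (tadd (tsubst (renv dbl) s) (tsubst (renv dbl1) t)), (merge phi psi).
  intros e; cbn; rewrite teval_merge_even, teval_merge_odd; congruence.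
Qed.

Lemma T0_mul f g : T0 f -> T0 g -> T0 (fun e => f e * g e).
Proof.
  intros [s [phi Hs]] [t [psi Ht]].
  exists (tmul (tsubst (renv dbl) s) (tsubst (renv dbl1) t)), (merge phi psi).
  intros e; cbn; rewrite teval_merge_even, teval_merge_odd; congruence.
Qed.


Lemma D0_eq f g : T0 f -> T0 g -> D0 (fun e => f e = g e).
Proof.
  intros [s [phi Hs]] [t [psi Ht]].
  exists (feq (tsubst (renv dbl) s) (tsubst (renv dbl1) t)), (merge phi psi), (fun _ => some_set).
  split; [constructor|].
  intros e; cbn; rewrite teval_merge_even, teval_merge_odd, Hs, Ht; reflexivity.
Qed.

Lemma D0_lt f g : T0 f -> T0 g -> D0 (fun e => f e < g e).
Proof.
  intros [s [phi Hs]] [t [psi Ht]].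
  exists (flt (tsubst (renv dbl) s) (tsubst (renv dbl1) t)), (merge phi psi), (fun _ => some_set).
  split; [constructor|].
  intros e; cbn; rewrite teval_merge_even, teval_merge_odd, Hs, Ht; reflexivity.
Qed.

Lemma D0_mem f X : T0 f -> D0 (fun e => f e in_set X).
Proof.
  intros [s [phi Hs]].
  exists (fmem s 0), phi, (fun _ => X). split; [constructor|].
  intros e; cbn; rewrite Hs; reflexivity.
Qed.

Lemma D0_False : D0 (fun _ => False).
Proof.
  exists fbot, (fun n => inl n), (fun _ => some_set). split; [constructor|reflexivity].
Qed.

Lemma D0_imp P Q : D0 P -> D0 Q -> D0 (fun e => P e -> Q e).
Proof.
  intros [A [phi [E [HA HP]]]] [B [psi [F [HB HQ]]]].
  exists (fimp (fsubst (renv dbl) dbl A) (fsubst (renv dbl1) dbl1 B)),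
    (merge phi psi), (merge E F).
  split; [constructor; apply delta0_subst; assumption|].
  intros e; cbn; rewrite sat_merge_even, sat_merge_odd, HP, HQ; reflexivity.
Qed.

(** Renaming that separates the argument [0] from the rest, under a quantifier. *)
Definition bind_ren (phi : assignment) (n : nat) : nat :=
  match phi n with inl 0%nat => 0 | _ => S n end.

Definition bind_assign (phi : assignment) (n : nat) : nat + num :=
  match phi n with inl m => inl (pred m) | inr a => inr a end.

Lemma sat_bind phi x e E A :
  sat model (scons x (assign (bind_assign phi) e)) E (fsubst (renv (bind_ren phi)) (fun X => X) A)
  = sat model (assign phi (scons x e)) E A.
Proof.
  rewrite sat_subst; f_equal; apply functional_extensionality; intros n.
  unfold renv, bind_ren, bind_assign, assign; cbn.
  destruct (phi n) as [[|m]|a] eqn:Hn; cbn; rewrite ?Hn; reflexivity.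
Qed.

Lemma D0_ball t (Q : env -> num -> Prop) :
  T0 t -> D0 (fun e => Q (fun n => e (S n)) (e 0%nat)) ->
  D0 (fun e => forall x, x < t e -> Q e x).
Proof.
  intros [s [phi Hs]] [A [psi [E [HA HQ]]]].
  exists (alln (fimp (flt (tvar 0) (tshift (tsubst (renv dbl) s)))
             (fsubst (upn (renv dbl1)) (fun X => X)
               (fsubst (renv (bind_ren psi)) (fun X => X) A)))),
    (merge phi (bind_assign psi)), E.
  split; [constructor; do 2 apply delta0_subst; assumption|].
  intros e; cbn. apply iff_trans with
    (forall x, x < t e -> sat model (assign psi (scons x e)) E A).
  - split; intros H x Hx; specialize (H x Hx);
      apply (HQ (scons x e)); exact H.
  - enough (H : forall x, sat model (scons x (assign (merge phi (bind_assign psi)) e)) E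
       (fsubst (upn (renv dbl1)) (fun X : nat => X)
          (fsubst (renv (bind_ren psi)) (fun X : nat => X) A))
       = sat model (assign psi (scons x e)) E A).
    { split; intros L x; rewrite ?H.
      - unfold tshift; rewrite tsubst_comp, teval_subst; cbn. intros Hx; apply L.
        rewrite Hs, <- (teval_merge_even phi (bind_assign psi)), teval_subst.
        exact Hx.
      - intros Hx; specialize (L x); rewrite H in L; apply L.
        rewrite Hs, <- (teval_merge_even phi (bind_assign psi)), teval_subst in Hx.
        unfold tshift; rewrite tsubst_comp, teval_subst; exact Hx. }
    intros x. rewrite sat_subst, <- sat_bind. f_equal.
    apply functional_extensionality; intros [|n]; cbn; [reflexivity|].
    apply (assign_merge_odd phi (bind_assign psi)).
Qed.

Lemma D0_not P : D0 P -> D0 (fun e => ~ P e).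
Proof. intros H; apply (D0_imp _ _ H D0_False). Qed.

Lemma D0_and P Q : D0 P -> D0 Q -> D0 (fun e => P e /\ Q e).
Proof.
  intros HP HQ; eapply D0_ext; [exact (D0_not _ (D0_imp _ _ HP (D0_not _ HQ)))|].
  intros e; cbn; tauto.
Qed.

Lemma D0_or P Q : D0 P -> D0 Q -> D0 (fun e => P e \/ Q e).
Proof.
  intros HP HQ; eapply D0_ext; [exact (D0_imp _ _ (D0_not _ HP) HQ)|].
  intros e; cbn; tauto.
Qed.

Lemma D0_bex t (Q : env -> num -> Prop) :
  T0 t -> D0 (fun e => Q (fun n => e (S n)) (e 0%nat)) ->
  D0 (fun e => exists x, x < t e /\ Q e x).
Proof.
  intros Ht HQ. eapply D0_ext.
  - apply D0_not, (D0_ball t (fun e x => ~ Q e x) Ht), (D0_not _ HQ).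
  - intros e; cbn; split.
    + intros [x [Hx Hq]] H; exact (H x Hx Hq).
    + intros H; apply NNPP; intros N; apply H; intros x Hx Hq; apply N; exists x; auto.
Qed.

(** The way back from predicates to syntax: the two arguments become the number variables 0 and 1,
    as the axiom schemes expect, and everything else becomes a parameter. *)
Lemma D0_bind2 P : D0 P -> exists B e E, delta0 B /\
  forall y x, P (scons y (scons x (fun _ => 0))) <-> sat model (scons y (scons x e)) E B.
Proof.
  intros [A [phi [E [HA HP]]]].
  exists (fsubst (upn (renv (bind_ren (bind_assign phi)))) (fun X => X)
            (fsubst (renv (bind_ren phi)) (fun X => X) A)),
    (assign (bind_assign (bind_assign phi)) (fun _ => 0)), E.
  split; [do 2 apply delta0_subst; assumption|].
  intros y x; rewrite HP, <- sat_bind. rewrite (sat_subst _ _ _ _ (upn _)).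
  assert (H : forall e e', e = e' -> forall B, sat model e E B <-> sat model e' E B)
    by (intros ? ? ->; reflexivity).
  apply H; clear H. apply functional_extensionality; intros [|n]; cbn; [reflexivity|].
  unfold renv, bind_ren at 1, bind_assign, assign; cbn.
  destruct (phi n) as [[|[|m]]|a] eqn:Hn; cbn; rewrite ?Hn; reflexivity.
Qed.

(** [D0] and [S1] are the Delta_0 and Sigma_1 predicates of an environment, with
    constants from the model; below, [D1] stands for Delta_1, and [T0] and [T1] for
    terms and for functions with Sigma_1 graph. *)
Definition S1 (P : env -> Prop) : Prop :=
  exists Q, D0 Q /\ forall e, P e <-> exists x, Q (scons x e).

Lemma S1_induction (P : num -> Prop) : S1 (fun e => P (e 0%nat)) ->
  P 0 -> (forall x, P x -> P (x + 1)) -> forall x, P x.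
Proof.
  intros [Q [HQ HP]] H0 HS.
  destruct (D0_bind2 _ HQ) as [B [e [E [HB HQB]]]].
  assert (HPB : forall x, P x <-> sat model (scons x e) E (exn B)).
  { intros x. rewrite sat_exn, (HP (scons x (fun _ => 0))).
    split; intros [y Hy]; exists y; apply HQB, Hy. }
  assert (I := model_axioms _ e E (RCA0_induction (exn B) (sigma01_ex B HB))).
  cbn [sat] in I. rewrite sat_and in I. cbn [sat] in I.
  intros x; apply HPB. revert x. apply I. split.
  - unfold instn; rewrite sat_subst. apply HPB in H0.
    replace (fun n => _) with (scons 0 e); [exact H0|].
    apply functional_extensionality; intros [|n]; reflexivity.
  - intros x Hx. apply HPB, HS, HPB in Hx.
    unfold succn; rewrite sat_subst.
    replace (fun n => _) with (scons (x + 1) e); [exact Hx|].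
    apply functional_extensionality; intros [|n]; reflexivity.
Qed.

Lemma D1_comprehension (P : num -> Prop) :
  S1 (fun e => P (e 0%nat)) -> S1 (fun e => ~ P (e 0%nat)) ->
  exists Z, forall x, x in_set Z <-> P x.
Proof.
  intros [Q1 [HQ1 HP1]] [Q2 [HQ2 HP2]].
  destruct (D0_bind2 _ HQ1) as [B1 [e1 [E1 [HB1 HQB1]]]].
  (* Negating the matrix of the Sigma_1 definition of the complement gives the Pi_1 formula that the
     comprehension axiom asks for. *)
  destruct (D0_bind2 _ (D0_not _ HQ2)) as [B2 [e2 [E2 [HB2 HQB2]]]].
  pose (C1 := fsubst (upn (upn (renv dbl))) dbl B1).
  pose (C2 := fsubst (upn (upn (renv dbl1))) dbl1 B2).
  assert (H1 : forall x, P x <-> sat model (scons x (merge e1 e2)) (merge E1 E2) (exn C1)).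
  { intros x. rewrite sat_exn, (HP1 (scons x (fun _ => 0))).
    enough (H : forall y, Q1 (scons y (scons x (fun _ => 0))) <->
       sat model (scons y (scons x (merge e1 e2))) (merge E1 E2) C1)
      by (split; intros [y Hy]; exists y; apply H, Hy).
    intros y. rewrite HQB1; unfold C1; rewrite sat_subst.
    replace (scons y (scons x e1)) with (fun n =>
      teval model (scons y (scons x (merge e1 e2))) (upn (upn (renv dbl)) n)).
    - replace (fun X => merge E1 E2 (dbl X)) with E1; [reflexivity|].
      apply functional_extensionality; intros; rewrite merge_even; reflexivity.
    - apply functional_extensionality; intros [|[|n]]; try reflexivity.
      apply (merge_even e1 e2). }
  assert (H2 : forall x, P x <-> sat model (scons x (merge e1 e2)) (merge E1 E2) (alln C2)).
  { intros x. cbn [sat].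
    enough (H : forall y, ~ Q2 (scons y (scons x (fun _ => 0))) <->
       sat model (scons y (scons x (merge e1 e2))) (merge E1 E2) C2).
    { specialize (HP2 (scons x (fun _ => 0))); cbn in HP2. split.
      - intros Hx y; apply H; intros Hy. apply HP2; [exists y|]; assumption.
      - intros Hy; apply NNPP; intros Hx; apply HP2 in Hx; destruct Hx as [y Hx].
        apply (proj2 (H y)); auto. }
    intros y. rewrite HQB2; unfold C2; rewrite sat_subst.
    replace (scons y (scons x e2)) with (fun n =>
      teval model (scons y (scons x (merge e1 e2))) (upn (upn (renv dbl1)) n)).
    - replace (fun X => merge E1 E2 (dbl1 X)) with E2; [reflexivity|].
      apply functional_extensionality; intros; rewrite merge_odd; reflexivity.
    - apply functional_extensionality; intros [|[|n]]; try reflexivity.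
      apply (merge_odd e1 e2). }
  assert (I := model_axioms _ (merge e1 e2) (merge E1 E2)
    (RCA0_comprehension (exn C1) (alln C2)
       (sigma01_ex C1 (delta0_subst _ HB1 _ _)) (pi01_all C2 (delta0_subst _ HB2 _ _)))).
  cbn [sat] in I. rewrite sat_exs in I.
  destruct I as [Z HZ].
  - intros x. apply sat_iff. rewrite <- H1, <- H2; reflexivity.
  - exists Z; intros x. cbn [sat] in HZ. specialize (HZ x).
    rewrite sat_iff in HZ. unfold shifts in HZ; rewrite sat_subst in HZ.
    apply (iff_trans HZ). symmetry; apply H1.
Qed.

Ltac ax A e := exact (model_axioms _ e (fun _ => some_set) A).

Lemma succ_neq_0 x : x + 1 <> 0.
Proof. ax RCA0_succ_neq0 (fun _ : nat => x). Qed.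

Lemma succ_inj x y : x + 1 = y + 1 -> x = y.
Proof. ax RCA0_succ_inj (scons x (fun _ => y)). Qed.

Lemma add_0_r x : x + 0 = x.
Proof. ax RCA0_add0 (fun _ : nat => x). Qed.

Lemma add_succ_r x y : x + (y + 1) = (x + y) + 1.
Proof. ax RCA0_addS (scons x (fun _ => y)). Qed.

Lemma mul_0_r x : x * 0 = 0.
Proof. ax RCA0_mul0 (fun _ : nat => x). Qed.

Lemma mul_succ_r x y : x * (y + 1) = x * y + x.
Proof. ax RCA0_mulS (scons x (fun _ => y)). Qed.

Lemma nlt_0_r x : ~ x < 0.
Proof. ax RCA0_lt0 (fun _ : nat => x). Qed.

Lemma lt_succ_r x y : x < y + 1 <-> x < y \/ x = y.
Proof.
  assert (H := model_axioms _ (scons x (fun _ => y)) (fun _ => some_set) RCA0_ltS).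
  rewrite sat_iff, sat_or in H. exact H.
Qed.

End Definability.

Ltac t0 := cbn beta; lazymatch goal with
  | |- T0 (fun e => s_add _ (@?f e) (@?g e)) => apply (T0_add f g); t0
  | |- T0 (fun e => s_mul _ (@?f e) (@?g e)) => apply (T0_mul f g); t0
  | |- T0 (fun e => e ?n) => apply (T0_var n)
  | |- T0 (fun _ => ?a) => apply (T0_const a)
  end.

Ltac d0 := cbn beta; lazymatch goal with
  | |- D0 (fun e => @?f e = @?g e) => apply (D0_eq f g); t0
  | |- D0 (fun e => s_lt _ (@?f e) (@?g e)) => apply (D0_lt f g); t0
  | |- D0 (fun e => s_mem _ (@?f e) ?X) => apply (D0_mem f X); t0
  | |- D0 (fun e => forall x, s_lt _ x (@?t e) -> @?Q e x) => apply (D0_ball t Q); [t0|d0]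
  | |- D0 (fun e => exists x, s_lt _ x (@?t e) /\ @?Q e x) => apply (D0_bex t Q); [t0|d0]
  | |- D0 (fun e => @?P e /\ @?Q e) => apply (D0_and P Q); d0
  | |- D0 (fun e => @?P e \/ @?Q e) => apply (D0_or P Q); d0
  | |- D0 (fun e => ~ @?P e) => apply (D0_not P); d0
  | |- D0 (fun e => False) => apply D0_False
  | |- D0 (fun e => @?P e -> @?Q e) => apply (D0_imp P Q); d0
  | _ => idtac
  end.

(** With this reading [le_refl] also proves [x < x + 1], and [le_0_l] proves that successors are
    positive; both are used in this way throughout. *)
Notation "x <= y" := (s_lt model x (s_add model y (s_one model))) : model_scope.

(** * Ordered semiring arithmetic in a model *)

Section Arithmetic.
Context {K : RCA0_model}.
Open Scope model_scope.
Notation env := (nat -> num).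

Lemma D0_inst P (phi : assignment) : D0 P -> D0 (fun e => P (assign phi e)).
Proof.
  intros [A [psi [E [HA HP]]]].
  exists A, (fun n => match psi n with inl m => phi m | inr a => inr a end), E.
  split; [assumption|]. intros e; rewrite HP.
  replace (assign psi (assign phi e)) with
    (assign (fun n => match psi n with inl m => phi m | inr a => inr a end) e);
    [reflexivity|].
  apply functional_extensionality; intros n; unfold assign.
  destruct (psi n); reflexivity.
Qed.

Lemma D0_shift P : D0 P -> D0 (fun e => P (fun n => e (S n))).
Proof. exact (D0_inst P (fun n => inl (S n))). Qed.

Lemma S1_D0 P : D0 P -> S1 P.
Proof.
  intros HP. exists (fun e => P (fun n => e (S n))); split; [apply D0_shift, HP|].
  intros e; split; [intros H; exists 0; exact H|intros [x H]; exact H].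
Qed.

Ltac nat_ind x := revert x;
  match goal with |- forall x, @?P x => apply (S1_induction P); [apply S1_D0; d0| |] end;
  cbn beta.

Lemma add_0_l x : 0 + x = x.
Proof.
  nat_ind x; [apply add_0_r|]. intros x IH; rewrite add_succ_r, IH; reflexivity.
Qed.

Lemma add_succ_l x y : (x + 1) + y = (x + y) + 1.
Proof.
  nat_ind y; [rewrite !add_0_r; reflexivity|].
  intros y IH; rewrite !add_succ_r, IH; reflexivity.
Qed.

Lemma add_comm x y : x + y = y + x.
Proof.
  nat_ind y; [rewrite add_0_r, add_0_l; reflexivity|].
  intros y IH; rewrite add_succ_r, add_succ_l, IH; reflexivity.
Qed.

Lemma add_assoc x y z : x + (y + z) = (x + y) + z.
Proof.
  nat_ind z; [rewrite !add_0_r; reflexivity|].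
  intros z IH; rewrite !add_succ_r, IH; reflexivity.
Qed.

Lemma mul_0_l x : 0 * x = 0.
Proof.
  nat_ind x; [apply mul_0_r|]. intros x IH; rewrite mul_succ_r, IH; apply add_0_r.
Qed.

Lemma mul_succ_l x y : (x + 1) * y = x * y + y.
Proof.
  nat_ind y; [rewrite !mul_0_r, add_0_r; reflexivity|].
  intros y IH. rewrite !mul_succ_r, IH, !add_succ_r. f_equal.
  rewrite <- !add_assoc; f_equal; apply add_comm.
Qed.

Lemma mul_comm x y : x * y = y * x.
Proof.
  nat_ind y; [rewrite mul_0_r, mul_0_l; reflexivity|].
  intros y IH; rewrite mul_succ_r, mul_succ_l, IH; reflexivity.
Qed.

Lemma mul_add_l x y z : (x + y) * z = x * z + y * z.
Proof.
  nat_ind z; [rewrite !mul_0_r, add_0_r; reflexivity|].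
  intros z IH. rewrite !mul_succ_r, IH, <- !add_assoc. f_equal.
  rewrite !add_assoc; f_equal; apply add_comm.
Qed.

Lemma mul_assoc x y z : x * (y * z) = (x * y) * z.
Proof.
  nat_ind z; [rewrite !mul_0_r; reflexivity|].
  intros z IH. rewrite !mul_succ_r, <- IH, mul_comm, mul_add_l.
  f_equal; apply mul_comm.
Qed.

Lemma mul_1_l x : 1 * x = x.
Proof.
  rewrite mul_comm. rewrite <- (add_0_l 1), mul_succ_r, mul_0_r. apply add_0_l.
Qed.

Lemma num_semi_ring : semi_ring_theory 0 1 (s_add model) (s_mul model) eq.
Proof.
  constructor; auto using add_0_l, add_comm, add_assoc, mul_1_l, mul_0_l, mul_comm,
    mul_assoc, mul_add_l.
Qed.
Add Ring num_ring : num_semi_ring.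

Lemma add_cancel_r x y z : x + z = y + z -> x = y.
Proof.
  nat_ind z; [rewrite !add_0_r; auto|].
  intros z IH; rewrite !add_succ_r; intros H; apply IH, succ_inj, H.
Qed.

Lemma add_cancel_l x y z : z + x = z + y -> x = y.
Proof. rewrite !(add_comm z); apply add_cancel_r. Qed.

Lemma zero_or_succ x : x = 0 \/ exists y, x = y + 1.
Proof.
  (* Bounding the predecessor by [x] makes the induction formula Delta_0. *)
  enough (x = 0 \/ exists y, y < x /\ x = y + 1) as [|[y [_ ->]]]; [auto|eauto|].
  nat_ind x; [auto|]. intros x _; right; exists x; split; [|reflexivity].
  apply lt_succ_r; auto.
Qed.

Lemma lt_succ_succ x y : x < y -> x + 1 < y + 1.
Proof.
  nat_ind y; [intros H; destruct (nlt_0_r _ H)|].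
  intros y IH H. apply lt_succ_r. apply lt_succ_r in H as [H| ->]; auto.
Qed.

Lemma lt_add_succ x z : x < x + z + 1.
Proof.
  nat_ind z; [rewrite add_0_r; apply lt_succ_r; auto|].
  intros z IH. rewrite add_succ_r. apply lt_succ_r; auto.
Qed.

Lemma lt_iff x y : x < y <-> exists z, y = x + z + 1.
Proof.
  split; [|intros [z ->]; apply lt_add_succ].
  enough (x < y -> exists z, z < y /\ y = x + z + 1) as H
      by (intros Hx; destruct (H Hx) as [z [_ Hz]]; exists z; exact Hz).
  nat_ind y; [intros H; destruct (nlt_0_r _ H)|].
  intros y IH H; apply lt_succ_r in H as [H| ->].
  - destruct (IH H) as [z [Hz Hy]]. exists (z + 1); split.
    + apply lt_succ_succ, Hz.
    + rewrite Hy; ring.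
  - exists 0; split; [|ring]. rewrite <- (add_0_l y). replace (0 + y + 1) with (0 + y + 1) by ring.
    apply lt_add_succ.
Qed.

Lemma le_iff x y : x <= y <-> exists z, y = x + z.
Proof.
  rewrite lt_iff; split; intros [z Hz]; exists z.
  - apply succ_inj, Hz.
  - rewrite Hz; reflexivity.
Qed.

Lemma add_eq_0 x y : x + y = 0 -> x = 0.
Proof.
  destruct (zero_or_succ x) as [->|[z ->]]; [auto|].
  intros H; destruct (succ_neq_0 (z + y)); rewrite <- H; ring.
Qed.

Lemma lt_le x y : x < y -> x + 1 <= y.
Proof. rewrite lt_iff, le_iff; intros [z ->]; exists z; ring. Qed.

(** Certificates for linear arithmetic: [a <= b] is a sum of known inequalities and
    [w] is the slack. *)
Lemma le_certificate a b x y w : a <= b -> a + y = b + x + w -> x <= y.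
Proof.
  rewrite !le_iff; intros [z ->] H. exists (z + w).
  apply (add_cancel_l _ _ a). rewrite H; ring.
Qed.

Lemma lt_certificate a b x y w : a <= b -> a + y = b + (x + 1) + w -> x < y.
Proof.
  rewrite le_iff, lt_iff; intros [z ->] H. exists (z + w).
  apply (add_cancel_l _ _ a). rewrite H; ring.
Qed.

Lemma le_add a b c d : a <= b -> c <= d -> a + c <= b + d.
Proof.
  rewrite !le_iff; intros [x ->] [y ->]; exists (x + y); ring.
Qed.

Lemma le_refl x : x <= x.
Proof. apply le_iff; exists 0; ring. Qed.

Lemma le_0_l x : 0 <= x.
Proof. apply le_iff; exists x; ring. Qed.

Lemma eq_le x y : x = y -> x <= y.
Proof. intros ->; apply le_refl. Qed.

Lemma eq_ge x y : x = y -> y <= x.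
Proof. intros ->; apply le_refl. Qed.

Lemma le_or_lt x y : x <= y \/ y < x.
Proof.
  nat_ind x; [left; apply le_0_l|].
  intros x [H|H].
  - apply lt_succ_r in H as [H| ->].
    + left. apply lt_succ_succ, H.
    + right; apply lt_succ_r; auto.
  - right; apply lt_succ_r; auto.
Qed.

End Arithmetic.

Ltac le_proof H :=
  lazymatch H with
  | (?H1, ?H2) => let a := le_proof H1 in let b := le_proof H2 in constr:(le_add _ _ _ _ a b)
  | _ => lazymatch type of H with
    | s_lt _ _ (s_add _ _ (s_one _)) => H
    | s_lt _ _ _ => constr:(lt_le _ _ H)
    | _ = _ => constr:(eq_le _ _ H)
    end
  end.

(** [lin (H1, .., Hn) w] proves an inequality that follows by adding up the
    (in)equalities [Hi] and the slack [w]. *)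
Ltac lin H w := let p := le_proof H in
  first [apply (le_certificate _ _ _ _ w p) | apply (lt_certificate _ _ _ _ w p)]; ring.

Section Classes.
Context {K : RCA0_model}.
Open Scope model_scope.
Notation env := (nat -> num).
Add Ring num_ring : num_semi_ring.

Lemma le_mul a b c d : a <= b -> c <= d -> a * c <= b * d.
Proof.
  rewrite !le_iff; intros [x ->] [y ->]; exists (a * y + x * c + x * y); ring.
Qed.

Lemma le_antisym x y : x <= y -> y <= x -> x = y.
Proof.
  rewrite !le_iff; intros [z ->] [w H].
  assert (z + w = 0) as Hz.
  { apply (add_cancel_l _ _ x). rewrite add_0_r, add_assoc, <- H; reflexivity. }
  rewrite (add_eq_0 _ _ Hz). symmetry; apply add_0_r.
Qed.

Lemma lt_irrefl x : ~ x < x.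
Proof.
  rewrite lt_iff; intros [z Hz]. apply (succ_neq_0 z).
  apply (add_cancel_l _ _ x). rewrite add_0_r, add_assoc; congruence.
Qed.

Lemma lt_le_incl x y : x < y -> x <= y.
Proof. intros H; apply lt_succ_r; auto. Qed.

Lemma le_lt_trans x y z : x <= y -> y < z -> x < z.
Proof.
  rewrite le_iff, !lt_iff. intros [u ->] [v ->]; exists (u + v); ring.
Qed.

Lemma lt_le_trans x y z : x < y -> y <= z -> x < z.
Proof.
  rewrite le_iff, !lt_iff. intros [u ->] [v ->]. exists (u + v); ring.
Qed.

Lemma le_trans x y z : x <= y -> y <= z -> x <= z.
Proof. rewrite !le_iff. intros [u ->] [v ->]. exists (u + v); ring. Qed.

Lemma lt_trans x y z : x < y -> y < z -> x < z.
Proof. intros H L; exact (lt_le_trans _ _ _ H (lt_le_incl _ _ L)). Qed.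

Lemma not_lt x y : ~ x < y <-> y <= x.
Proof.
  split; [destruct (le_or_lt y x); tauto|].
  intros H L; exact (lt_irrefl _ (lt_le_trans _ _ _ L H)).
Qed.

Lemma not_le x y : ~ x <= y <-> y < x.
Proof.
  split; [destruct (le_or_lt x y); tauto|].
  intros H L; exact (lt_irrefl _ (lt_le_trans _ _ _ H L)).
Qed.

Lemma lt_trichotomy x y : x < y \/ x = y \/ y < x.
Proof. destruct (le_or_lt x y) as [H|]; [apply lt_succ_r in H as [|]|]; auto. Qed.

Lemma lt_neq x y : x < y -> x <> y.
Proof. intros H ->; exact (lt_irrefl _ H). Qed.

Lemma pos_iff x : 0 < x <-> x <> 0.
Proof.
  split; [intros H ->; exact (lt_irrefl _ H)|].
  destruct (zero_or_succ x) as [->|[y ->]]; [tauto|]. intros _; apply le_0_l.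
Qed.

Lemma lt_1_r x : x < 1 <-> x = 0.
Proof.
  rewrite <- (add_0_l 1), lt_succ_r. split; [|auto].
  intros [H|]; [destruct (nlt_0_r _ H)|assumption].
Qed.

(** * Collection and the class of [S1] predicates *)

(** Sigma_1 induction on the length [n] of the initial segment already bounded; the guard [n <= b]
    makes the statement trivial beyond [b]. The purpose is to move bounded quantifiers inside a
    Sigma_1 predicate. *)
Lemma collection (R : num -> num -> Prop) b :
  D0 (fun e => R (e 1%nat) (e 0%nat)) -> (forall x, x < b -> exists y, R x y) ->
  exists c, forall x, x < b -> exists y, y < c /\ R x y.
Proof.
  intros HR H.
  enough (L : forall n, exists c, n <= b -> forall x, x < n -> exists y, y < c /\ R x y)
    by (destruct (L b) as [c Hc]; exists c; apply Hc, le_refl).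
  apply (S1_induction (fun n => exists c, n <= b -> forall x, x < n -> exists y, y < c /\ R x y)).
  - exists (fun e => e 1%nat <= b -> forall x, x < e 1%nat -> exists y, y < e 0%nat /\ R x y).
    split; [|intros e; reflexivity]. d0. exact HR.
  - exists 0; intros _ x Hx; destruct (nlt_0_r _ Hx).
  - intros n [c Hc]. destruct (classic (n < b)) as [Hn|Hn].
    + destruct (H n Hn) as [y Hy]. exists (c + y + 1). intros _ x Hx.
      apply lt_succ_r in Hx as [Hx| ->].
      * destruct (Hc (lt_le_incl _ _ Hn) x Hx) as [z [Hz Hxz]].
        exists z; split; [|assumption].
        apply (lt_le_trans _ _ _ Hz), le_iff; exists (y + 1); ring.
      * exists y; split; [|assumption]. apply lt_iff; exists c; ring.
    + exists 0; intros Hb; destruct Hn. lin Hb 0.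
Qed.
Lemma S1_ext P Q : S1 P -> (forall e, Q e <-> P e) -> S1 Q.
Proof.
  intros [R [HR HP]] H. exists R; split; [assumption|].
  intros e; rewrite H; apply HP.
Qed.

Lemma S1_inst P (phi : assignment) : S1 P -> S1 (fun e => P (assign phi e)).
Proof.
  intros [Q [HQ HP]].
  exists (fun e => Q (assign (fun n => match n with
     | 0 => inl 0%nat
     | S n => match phi n with inl m => inl (S m) | inr a => inr a end end) e)).
  split; [apply (D0_inst _ _ HQ)|].
  intros e; rewrite HP.
  assert (H : forall x, assign (fun n => match n with
     | 0 => inl 0%nat
     | S n => match phi n with inl m => inl (S m) | inr a => inr a end end) (scons x e)
     = scons x (assign phi e)).
  { intros x. apply functional_extensionality; intros [|n]; [reflexivity|].
    unfold assign; cbn; destruct (phi n); reflexivity. }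
  split; intros [x Hx]; exists x; [rewrite H|rewrite <- H]; exact Hx.
Qed.

Lemma S1_and P Q : S1 P -> S1 Q -> S1 (fun e => P e /\ Q e).
Proof.
  intros [P0 [HP0 HP]] [Q0 [HQ0 HQ]].
  exists (fun e => (exists x, x < e 0%nat /\ P0 (scons x (fun n => e (S n)))) /\
             (exists x, x < e 0%nat /\ Q0 (scons x (fun n => e (S n))))).
  split.
  - d0.
    + refine (D0_ext _ _ (D0_inst P0 (fun n => match n with
         | 0 => inl 0%nat | S n => inl (S (S n)) end) HP0) _).
      intros e; replace (assign _ e) with (scons (e 0%nat) (fun n => e (S (S n))));
      [reflexivity|apply functional_extensionality; intros [|n]; reflexivity].
    + refine (D0_ext _ _ (D0_inst Q0 (fun n => match n with
         | 0 => inl 0%nat | S n => inl (S (S n)) end) HQ0) _).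
      intros e; replace (assign _ e) with (scons (e 0%nat) (fun n => e (S (S n))));
      [reflexivity|apply functional_extensionality; intros [|n]; reflexivity].
  - intros e; rewrite HP, HQ; cbn. split.
    + intros [[x Hx] [y Hy]]. exists (x + y + 1). split.
      * exists x; split; [apply lt_iff; exists y; reflexivity|exact Hx].
      * exists y; split; [apply lt_iff; exists x; ring|exact Hy].
    + intros [c [[x [_ Hx]] [y [_ Hy]]]]; split; eauto.
Qed.

Lemma S1_or P Q : S1 P -> S1 Q -> S1 (fun e => P e \/ Q e).
Proof.
  intros [P0 [HP0 HP]] [Q0 [HQ0 HQ]].
  exists (fun e => P0 e \/ Q0 e); split; [apply (D0_or _ _ HP0 HQ0)|].
  intros e; rewrite HP, HQ; split.
  - intros [[x Hx]|[x Hx]]; exists x; auto.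
  - intros [x [Hx|Hx]]; eauto.
Qed.

Lemma S1_ex (Q : env -> num -> Prop) :
  S1 (fun e => Q (fun n => e (S n)) (e 0%nat)) -> S1 (fun e => exists x, Q e x).
Proof.
  intros [R [HR HQ]].
  exists (fun e => exists x, x < e 0%nat /\ exists y, y < e 0%nat /\
             R (scons y (scons x (fun n => e (S n))))).
  split.
  - apply (D0_bex (fun e => e 0%nat) (fun e x => exists y, y < e 0%nat /\
             R (scons y (scons x (fun n => e (S n)))))); [t0|].
    apply (D0_bex (fun e => e 1%nat) (fun e y => R (scons y (scons (e 0%nat) (fun n => e (S (S n))))))); [t0|].
    refine (D0_ext _ _ (D0_inst R (fun n => match n with
         | 0 => inl 0%nat | 1 => inl 1%nat | S n => inl (S (S n)) end) HR) _).
    intros e; replace (assign _ e) with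
      (scons (e 0%nat) (scons (e 1%nat) (fun n => e (S (S (S n))))));
      [reflexivity|apply functional_extensionality; intros [|[|n]]; reflexivity].
  - intros e; split.
    + intros [x Hx]. apply (HQ (scons x e)) in Hx as [y Hy].
      exists (x + y + 1), x; split; [apply lt_iff; exists y; reflexivity|].
      exists y; split; [apply lt_iff; exists x; cbn; ring|exact Hy].
    + intros [c [x [_ [y [_ Hy]]]]]. exists x. apply (HQ (scons x e)). eauto.
Qed.

(** For a total function a Sigma_1 graph is enough: the value can be guessed by an existential
    quantifier. Doing this for a predicate and for its complement keeps Delta_1 closed under such
    functions. *)
Definition T1 (f : env -> num) : Prop := S1 (fun e => e 0%nat = f (fun n => e (S n))).

Lemma T1_T0 f : T0 f -> T1 f.
Proof.
  intros [t [phi Hf]]. apply S1_D0, D0_eq; [apply T0_var|].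
  exists t, (fun n => match phi n with inl m => inl (S m) | inr a => inr a end).
  intros e; rewrite Hf; f_equal; apply functional_extensionality; intros n.
  unfold assign; destruct (phi n); reflexivity.
Qed.

Lemma S1_subst P f : S1 P -> T1 f -> S1 (fun e => P (scons (f e) e)).
Proof.
  intros HP Hf. apply (S1_ext (fun e => exists v, v = f e /\ P (scons v e))).
  - apply (S1_ex (fun e v => v = f e /\ P (scons v e))), S1_and; [exact Hf|].
    refine (S1_ext _ _ HP _). intros e; rewrite scons_eta; reflexivity.
  - intros e; split; [intros H; exists (f e); auto|intros [v [-> H]]; exact H].
Qed.

Lemma S1_shift P : S1 P -> S1 (fun e => P (fun n => e (S n))).
Proof. exact (S1_inst P (fun n => inl (S n))). Qed.

Lemma T1_shift f : T1 f -> T1 (fun e => f (fun n => e (S n))).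
Proof.
  exact (S1_inst _ (fun n => match n with 0 => inl 0%nat | S n => inl (S (S n)) end)).
Qed.

Lemma S1_app1 (R : num -> Prop) f :
  S1 (fun e => R (e 0%nat)) -> T1 f -> S1 (fun e => R (f e)).
Proof. intros HR Hf; exact (S1_subst _ _ HR Hf). Qed.

Lemma S1_app2 (R : num -> num -> Prop) f g :
  S1 (fun e => R (e 0%nat) (e 1%nat)) -> T1 f -> T1 g -> S1 (fun e => R (f e) (g e)).
Proof.
  intros HR Hf Hg.
  refine (S1_subst (fun e => R (f (fun n => e (S n))) (e 0%nat)) g _ Hg).
  refine (S1_subst (fun e => R (e 0%nat) (e 1%nat)) _ HR (T1_shift _ Hf)).
Qed.

Lemma S1_app3 (R : num -> num -> num -> Prop) f g h :
  S1 (fun e => R (e 0%nat) (e 1%nat) (e 2%nat)) -> T1 f -> T1 g -> T1 h ->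
  S1 (fun e => R (f e) (g e) (h e)).
Proof.
  intros HR Hf Hg Hh.
  refine (S1_subst (fun e => R (f (fun n => e (S n))) (g (fun n => e (S n))) (e 0%nat)) h _ Hh).
  refine (S1_subst (fun e => R (f (fun n => e (S (S n)))) (e 0%nat) (e 1%nat)) _ _ (T1_shift _ Hg)).
  refine (S1_subst (fun e => R (e 0%nat) (e 1%nat) (e 2%nat)) _ HR (T1_shift _ (T1_shift _ Hf))).
Qed.

(** Collection bounds the witnesses for all [x < t] at once, and this bound becomes the single outer
    witness. *)
Lemma S1_ball t (Q : env -> num -> Prop) :
  T1 t -> S1 (fun e => Q (fun n => e (S n)) (e 0%nat)) ->
  S1 (fun e => forall x, x < t e -> Q e x).
Proof.
  intros Ht [R [HR HQ]].
  refine (S1_subst (fun e => forall x, x < e 0%nat -> Q (fun n => e (S n)) x) t _ Ht).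
  exists (fun e => forall x, x < e 1%nat -> exists y, y < e 0%nat /\
             R (scons y (scons x (fun n => e (S (S n)))))).
  split.
  - apply (D0_ball (fun e => e 1%nat) (fun e x => exists y, y < e 0%nat /\
             R (scons y (scons x (fun n => e (S (S n))))))); [t0|].
    apply (D0_bex (fun e => e 1%nat) (fun e y => R (scons y (scons (e 0%nat) (fun n => e (S (S (S n)))))))); [t0|].
    refine (D0_ext _ _ (D0_inst R (fun n => match n with
         | 0 => inl 0%nat | 1 => inl 1%nat | S n => inl (S (S (S n))) end) HR) _).
    intros e; replace (assign _ e) with
      (scons (e 0%nat) (scons (e 1%nat) (fun n => e (S (S (S (S n)))))));
      [reflexivity|apply functional_extensionality; intros [|[|n]]; reflexivity].
  - intros e; split.
    + intros H.
      destruct (collection (fun x y => R (scons y (scons x (fun n => e (S n))))) (e 0%nat))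
        as [c Hc].
      * refine (D0_ext _ _ (D0_inst R (fun n => match n with
         | 0 => inl 0%nat | 1 => inl 1%nat | S (S n) => inr (e (S n)) end) HR) _).
        intros e'; replace (assign _ e') with
          (scons (e' 0%nat) (scons (e' 1%nat) (fun n => e (S n))));
        [reflexivity|apply functional_extensionality; intros [|[|n]]; reflexivity].
      * intros x Hx. apply (HQ (scons x (fun n => e (S n)))), H, Hx.
      * exists c; exact Hc.
    + intros [c Hc] x Hx. destruct (Hc x Hx) as [y [_ Hy]].
      apply (HQ (scons x (fun n => e (S n)))). eauto.
Qed.

Definition D1 (P : env -> Prop) : Prop := S1 P /\ S1 (fun e => ~ P e).

Lemma D1_S1 P : D1 P -> S1 P.
Proof. intros [H _]; exact H. Qed.

Lemma D1_D0 P : D0 P -> D1 P.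
Proof. intros H; split; apply S1_D0; [exact H|apply D0_not, H]. Qed.

Lemma D1_ext P Q : D1 P -> (forall e, Q e <-> P e) -> D1 Q.
Proof.
  intros [H1 H2] H; split; [apply (S1_ext _ _ H1 H)|].
  apply (S1_ext _ _ H2); intros e; rewrite H; reflexivity.
Qed.

Lemma S1_not P : D1 P -> S1 (fun e => ~ P e).
Proof. intros [_ H]; exact H. Qed.

Lemma D1_not P : D1 P -> D1 (fun e => ~ P e).
Proof.
  intros [H1 H2]; split; [assumption|]. apply (S1_ext _ _ H1); intros e; tauto.
Qed.

Lemma D1_and P Q : D1 P -> D1 Q -> D1 (fun e => P e /\ Q e).
Proof.
  intros [H1 H2] [L1 L2]; split; [apply S1_and; assumption|].
  apply (S1_ext _ _ (S1_or _ _ H2 L2)); intros e; tauto.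
Qed.

Lemma D1_or P Q : D1 P -> D1 Q -> D1 (fun e => P e \/ Q e).
Proof.
  intros [H1 H2] [L1 L2]; split; [apply S1_or; assumption|].
  apply (S1_ext _ _ (S1_and _ _ H2 L2)); intros e; tauto.
Qed.

Lemma S1_imp P Q : D1 P -> S1 Q -> S1 (fun e => P e -> Q e).
Proof.
  intros [H1 H2] HQ. apply (S1_ext _ _ (S1_or _ _ H2 HQ)); intros e; tauto.
Qed.

Lemma D1_imp P Q : D1 P -> D1 Q -> D1 (fun e => P e -> Q e).
Proof.
  intros HP HQ. apply (D1_ext _ _ (D1_or _ _ (D1_not _ HP) HQ)); intros e; tauto.
Qed.

Lemma D1_iff P Q : D1 P -> D1 Q -> D1 (fun e => P e <-> Q e).
Proof. intros HP HQ. apply D1_and; apply D1_imp; assumption. Qed.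

Lemma S1_bex t (Q : env -> num -> Prop) :
  T1 t -> S1 (fun e => Q (fun n => e (S n)) (e 0%nat)) ->
  S1 (fun e => exists x, x < t e /\ Q e x).
Proof.
  intros Ht HQ. apply (S1_ex (fun e x => x < t e /\ Q e x)), S1_and; [|exact HQ].
  apply (S1_app2 (fun x y => x < y) (fun e => e 0%nat) (fun e => t (fun n => e (S n)))).
  - apply S1_D0; d0.
  - apply T1_T0; t0.
  - apply T1_shift, Ht.
Qed.

Lemma D1_ball t (Q : env -> num -> Prop) :
  T1 t -> D1 (fun e => Q (fun n => e (S n)) (e 0%nat)) ->
  D1 (fun e => forall x, x < t e -> Q e x).
Proof.
  intros Ht [H1 H2]; split; [apply S1_ball; assumption|].
  refine (S1_ext _ _ (S1_bex t (fun e x => ~ Q e x) Ht H2) _).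
  intros e; split.
  - intros H; apply NNPP; intros L; apply H; intros x Hx; apply NNPP; intros Hq.
    apply L; exists x; auto.
  - intros [x [Hx Hq]] H; exact (Hq (H x Hx)).
Qed.

Lemma D1_bex t (Q : env -> num -> Prop) :
  T1 t -> D1 (fun e => Q (fun n => e (S n)) (e 0%nat)) ->
  D1 (fun e => exists x, x < t e /\ Q e x).
Proof.
  intros Ht HQ. apply (D1_ext _ _ (D1_not _ (D1_ball t (fun e x => ~ Q e x) Ht (D1_not _ HQ)))).
  intros e; split.
  - intros [x [Hx Hq]] H; exact (H x Hx Hq).
  - intros H; apply NNPP; intros N; apply H; intros x Hx Hq; apply N; exists x; auto.
Qed.

Lemma D1_app1 (R : num -> Prop) f :
  D1 (fun e => R (e 0%nat)) -> T1 f -> D1 (fun e => R (f e)).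
Proof.
  intros [H1 H2] Hf; split; [exact (S1_app1 R f H1 Hf)|exact (S1_app1 (fun x => ~ R x) f H2 Hf)].
Qed.

Lemma D1_app2 (R : num -> num -> Prop) f g :
  D1 (fun e => R (e 0%nat) (e 1%nat)) -> T1 f -> T1 g -> D1 (fun e => R (f e) (g e)).
Proof.
  intros [H1 H2] Hf Hg; split;
    [exact (S1_app2 R f g H1 Hf Hg)|exact (S1_app2 (fun x y => ~ R x y) f g H2 Hf Hg)].
Qed.

Lemma D1_app3 (R : num -> num -> num -> Prop) f g h :
  D1 (fun e => R (e 0%nat) (e 1%nat) (e 2%nat)) -> T1 f -> T1 g -> T1 h ->
  D1 (fun e => R (f e) (g e) (h e)).
Proof.
  intros [H1 H2] Hf Hg Hh; split;
    [exact (S1_app3 R f g h H1 Hf Hg Hh)|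
     exact (S1_app3 (fun x y z => ~ R x y z) f g h H2 Hf Hg Hh)].
Qed.

Lemma D1_eq f g : T1 f -> T1 g -> D1 (fun e => f e = g e).
Proof. apply (D1_app2 (fun x y => x = y)), D1_D0; d0. Qed.

Lemma D1_lt f g : T1 f -> T1 g -> D1 (fun e => f e < g e).
Proof. apply (D1_app2 (fun x y => x < y)), D1_D0; d0. Qed.

Lemma D1_mem f X : T1 f -> D1 (fun e => f e in_set X).
Proof. apply (D1_app1 (fun x => x in_set X)), D1_D0; d0. Qed.

Lemma T1_app1 (F : num -> num) f :
  T1 (fun e => F (e 0%nat)) -> T1 f -> T1 (fun e => F (f e)).
Proof.
  intros HF Hf.
  apply (S1_app2 (fun x y => y = F x) (fun e => f (fun n => e (S n))) (fun e => e 0%nat)).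
  - exact (S1_inst _ (fun n => match n with 0 => inl 1%nat | 1 => inl 0%nat | _ => inl n end) HF).
  - apply T1_shift, Hf.
  - apply T1_T0; t0.
Qed.

Lemma T1_app2 (F : num -> num -> num) f g :
  T1 (fun e => F (e 0%nat) (e 1%nat)) -> T1 f -> T1 g -> T1 (fun e => F (f e) (g e)).
Proof.
  intros HF Hf Hg.
  apply (S1_app3 (fun z x y => z = F x y) (fun e => e 0%nat) (fun e => f (fun n => e (S n)))
           (fun e => g (fun n => e (S n)))).
  - exact HF.
  - apply T1_T0; t0.
  - apply T1_shift, Hf.
  - apply T1_shift, Hg.
Qed.

Lemma T1_app3 (F : num -> num -> num -> num) f g h :
  T1 (fun e => F (e 0%nat) (e 1%nat) (e 2%nat)) -> T1 f -> T1 g -> T1 h ->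
  T1 (fun e => F (f e) (g e) (h e)).
Proof.
  intros HF Hf Hg Hh.
  refine (S1_subst (fun e => e 1%nat = F (f (fun n => e (S (S n)))) (g (fun n => e (S (S n)))) (e 0%nat))
            (fun e => h (fun n => e (S n))) _ (T1_shift _ Hh)).
  refine (S1_subst (fun e => e 2%nat = F (f (fun n => e (S (S (S n))))) (e 0%nat) (e 1%nat))
            (fun e => g (fun n => e (S (S n)))) _ (T1_shift _ (T1_shift _ Hg))).
  refine (S1_subst (fun e => e 3%nat = F (e 0%nat) (e 1%nat) (e 2%nat))
            (fun e => f (fun n => e (S (S (S n))))) _ (T1_shift _ (T1_shift _ (T1_shift _ Hf)))).
  exact (S1_inst _ (fun n => match n with 0 => inl 3%nat | S n => inl n end) HF).
Qed.

Lemma T1_add f g : T1 f -> T1 g -> T1 (fun e => f e + g e).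
Proof. apply (T1_app2 (fun x y => x + y)), T1_T0; t0. Qed.

Lemma T1_mul f g : T1 f -> T1 g -> T1 (fun e => f e * g e).
Proof. apply (T1_app2 (fun x y => x * y)), T1_T0; t0. Qed.

Lemma T1_var n : T1 (fun e => e n).
Proof. apply T1_T0, T0_var. Qed.

Lemma T1_const a : T1 (fun _ => a).
Proof. apply T1_T0, T0_const. Qed.

(** The case distinction is made in the metatheory; by [T1_ite] it is available inside the model
    when the condition is Delta_1. *)
Definition ite (P : Prop) (a b : num) : num :=
  if excluded_middle_informative P then a else b.

Lemma ite_true P a b : P -> ite P a b = a.
Proof. intros H; unfold ite; destruct excluded_middle_informative; tauto. Qed.

Lemma ite_false P a b : ~ P -> ite P a b = b.
Proof. intros H; unfold ite; destruct excluded_middle_informative; tauto. Qed.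

Lemma T1_ite P f g : D1 P -> T1 f -> T1 g -> T1 (fun e => ite (P e) (f e) (g e)).
Proof.
  intros [H1 H2] Hf Hg.
  refine (S1_ext _ _ (S1_or _ _ (S1_and _ _ (S1_shift _ H1) Hf) (S1_and _ _ (S1_shift _ H2) Hg)) _).
  intros e; unfold ite; destruct excluded_middle_informative; tauto.
Qed.

(** * Least and greatest elements *)

(** A counterexample [a] is pushed downwards: by Sigma_1 induction on [y], the predicate fails at
    [a - y] for every [y <= a], finally at 0. *)
Lemma P1_induction (P : num -> Prop) : S1 (fun e => ~ P (e 0%nat)) ->
  P 0 -> (forall x, P x -> P (x + 1)) -> forall x, P x.
Proof.
  intros HP H0 HS a. apply NNPP; intros Ha.
  assert (L : forall y, y <= a -> exists z, z + y = a /\ ~ P z).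
  { apply (S1_induction (fun y => y <= a -> exists z, z + y = a /\ ~ P z)).
    - apply S1_imp; [apply D1_D0; d0|].
      apply (S1_ex (fun e z => z + e 0%nat = a /\ ~ P z)), S1_and; [apply S1_D0; d0|exact HP].
    - intros _; exists a; split; [ring|assumption].
    - intros y IH Hy. destruct IH as [z [Hz Hpz]]; [lin Hy 1|].
      + destruct (zero_or_succ z) as [->|[w ->]]; [contradiction|].
        exists w; split; [rewrite <- Hz; ring|]. intros Hw; apply Hpz, HS, Hw. }
  destruct (L a (le_refl a)) as [z [Hz Hpz]]. apply Hpz.
  replace z with 0; [assumption|]. apply (add_cancel_r _ _ a). rewrite Hz; ring.
Qed.

Lemma S1_least (P : num -> Prop) a : S1 (fun e => P (e 0%nat)) -> P a ->
  exists x, P x /\ forall y, y < x -> ~ P y.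
Proof.
  intros HP Ha. apply NNPP; intros N.
  assert (L : forall x, forall y, y < x -> ~ P y).
  { apply (P1_induction (fun x => forall y, y < x -> ~ P y)).
    - refine (S1_ext _ _ (S1_bex (fun e => e 0%nat) (fun _ y => P y) (T1_var 0) HP) _).
      intros e; split.
      + intros H; apply NNPP; intros L; apply H; intros y Hy Hpy; apply L; eauto.
      + intros [y [Hy Hpy]] H; exact (H y Hy Hpy).
    - intros y Hy; destruct (nlt_0_r _ Hy).
    - intros x IH y Hy Hpy. apply lt_succ_r in Hy as [Hy| ->]; [exact (IH y Hy Hpy)|].
      apply N; exists x; auto. }
  exact (L (a + 1) a (le_refl a) Ha).
Qed.

(** The greatest element is the one with the least distance from the bound [b]. *)
Lemma S1_greatest (P : num -> Prop) a b : S1 (fun e => P (e 0%nat)) ->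
  (forall x, P x -> x <= b) -> P a -> exists x, P x /\ forall y, P y -> y <= x.
Proof.
  intros HP Hb Ha.
  destruct (proj1 (le_iff _ _) (Hb a Ha)) as [d Hd].
  destruct (S1_least (fun z => exists x, b = x + z /\ P x) d) as [z [[x [Hz Hx]] H]].
  - apply (S1_ex (fun e x => b = x + e 0%nat /\ P x)), S1_and; [apply S1_D0; d0|].
    exact HP.
  - exists a; auto.
  - exists x; split; [assumption|]. intros y Hy. apply not_lt; intros Hxy.
    destruct (proj1 (le_iff _ _) (Hb y Hy)) as [w Hw].
    apply (H w); [|exists y; auto].
    assert (Hwz := eq_ge _ _ (eq_trans (eq_sym Hz) Hw)). lin (Hxy, Hwz) 0.
Qed.

End Classes.

(** [d1], [s1] and [t1] establish definability by following the structure of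
    the predicate; the database [rec] holds the named functions and predicates. *)
Create HintDb rec discriminated.

Ltac d1 := cbn beta; lazymatch goal with
  | |- D1 (fun e => s_lt _ (@?f e) (@?g e)) => apply (D1_lt f g); t1
  | |- D1 (fun e => s_mem _ (@?f e) ?X) => apply (D1_mem f X); t1
  | |- D1 (fun e => forall x, s_lt _ x (@?t e) -> @?Q e x) => apply (D1_ball t Q); [t1|d1]
  | |- D1 (fun e => exists x, s_lt _ x (@?t e) /\ @?Q e x) => apply (D1_bex t Q); [t1|d1]
  | |- D1 (fun e => @?P e /\ @?Q e) => apply (D1_and P Q); d1
  | |- D1 (fun e => @?P e \/ @?Q e) => apply (D1_or P Q); d1
  | |- D1 (fun e => @?P e <-> @?Q e) => apply (D1_iff P Q); d1
  | |- D1 (fun e => ~ @?P e) => apply (D1_not P); d1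
  | |- D1 (fun e => False) => apply D1_D0, D0_False
  | |- D1 (fun e => @?P e -> @?Q e) => apply (D1_imp P Q); d1
  | |- D1 (fun e => @?f e = @?g e) => apply (D1_eq f g); t1
  | |- _ => first
    [ assumption
    | match goal with |- D1 (fun e => ?R (@?f e) (@?g e) (@?h e)) =>
        apply (D1_app3 R f g h); [solve [assumption|eauto with rec]|t1|t1|t1] end
    | match goal with |- D1 (fun e => ?R (@?f e) (@?g e)) =>
        apply (D1_app2 R f g); [solve [assumption|eauto with rec]|t1|t1] end
    | match goal with |- D1 (fun e => ?R (@?f e)) =>
        apply (D1_app1 R f); [solve [assumption|eauto with rec]|t1] end
    | idtac ]
  end
with t1 := cbn beta; lazymatch goal with
  | |- T1 (fun e => s_add _ (@?f e) (@?g e)) => apply (T1_add f g); t1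
  | |- T1 (fun e => s_mul _ (@?f e) (@?g e)) => apply (T1_mul f g); t1
  | |- T1 (fun e => ite (@?P e) (@?f e) (@?g e)) => apply (T1_ite P f g); [d1|t1|t1]
  | |- T1 (fun e => e ?n) => apply (T1_var n)
  | |- T1 (fun _ => ?a) => apply (T1_const a)
  | |- _ => first
    [ assumption
    | match goal with |- T1 (fun e => ?F (@?f e) (@?g e) (@?h e)) =>
        apply (T1_app3 F f g h); [solve [assumption|eauto with rec]|t1|t1|t1] end
    | match goal with |- T1 (fun e => ?F (@?f e) (@?g e)) =>
        apply (T1_app2 F f g); [solve [assumption|eauto with rec]|t1|t1] end
    | match goal with |- T1 (fun e => ?F (@?f e)) =>
        apply (T1_app1 F f); [solve [assumption|eauto with rec]|t1] end
    | idtac ]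
  end.

Ltac s1 := cbn beta; lazymatch goal with
  | |- S1 (fun e => s_lt _ _ _) => apply D1_S1; d1
  | |- S1 (fun e => s_mem _ _ _) => apply D1_S1; d1
  | |- S1 (fun e => forall x, s_lt _ x (@?t e) -> @?Q e x) => apply (S1_ball t Q); [t1|s1]
  | |- S1 (fun e => exists x, @?Q e x) => apply (S1_ex Q); s1
  | |- S1 (fun e => @?P e /\ @?Q e) => apply (S1_and P Q); s1
  | |- S1 (fun e => @?P e \/ @?Q e) => apply (S1_or P Q); s1
  | |- S1 (fun e => ~ @?P e) => apply (S1_not P); d1
  | |- S1 (fun e => False) => apply S1_D0, D0_False
  | |- S1 (fun e => @?P e -> @?Q e) => apply (S1_imp P Q); [d1|s1]
  | |- S1 (fun e => _ = _) => apply D1_S1; d1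
  | |- _ => first
    [ assumption
    | match goal with |- S1 (fun e => ?R (@?f e) (@?g e) (@?h e)) =>
        apply (S1_app3 R f g h); [solve [assumption|eauto with rec]|t1|t1|t1] end
    | match goal with |- S1 (fun e => ?R (@?f e) (@?g e)) =>
        apply (S1_app2 R f g); [solve [assumption|eauto with rec]|t1|t1] end
    | match goal with |- S1 (fun e => ?R (@?f e)) =>
        apply (S1_app1 R f); [solve [assumption|eauto with rec]|t1] end
    | apply D1_S1; d1 ]
  end.

(** * Minimization, division and the coding of finite sequences *)

Section Recursion.
Context {K : RCA0_model}.
Open Scope model_scope.
Notation env := (nat -> num).
Add Ring num_ring : num_semi_ring.

(** A description in the metatheory, arbitrary if there is no least element. [T1_mu] brings it into
    the model for total searches over Delta_1 predicates. *)
Definition mu (P : num -> Prop) : num :=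
  epsilon (inhabits 0) (fun y => P y /\ forall z, z < y -> ~ P z).

Lemma mu_spec (P : num -> Prop) : S1 (fun e => P (e 0%nat)) -> (exists y, P y) ->
  P (mu P) /\ forall z, z < mu P -> ~ P z.
Proof.
  intros HP [y Hy]. unfold mu; apply epsilon_spec, (S1_least P y HP Hy).
Qed.

Lemma mu_eq (P : num -> Prop) y : P y -> (forall z, z < y -> ~ P z) -> mu P = y.
Proof.
  intros Hy Hlt. unfold mu.
  destruct (epsilon_spec (inhabits 0) (fun y => P y /\ forall z, z < y -> ~ P z))
    as [H L]; [eauto|].
  destruct (lt_trichotomy (epsilon (inhabits 0) (fun y => P y /\ forall z, z < y -> ~ P z)) y)
    as [N|[N|N]]; [destruct (Hlt _ N H)|exact N|destruct (L _ N Hy)].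
Qed.

Lemma T1_mu (R : env -> num -> Prop) :
  D1 (fun e => R (fun n => e (S n)) (e 0%nat)) -> (forall e, exists y, R e y) ->
  T1 (fun e => mu (fun y => R e y)).
Proof.
  intros HR Htot. apply D1_S1.
  refine (D1_ext (fun e => R (fun n => e (S n)) (e 0%nat) /\
            forall z, z < e 0%nat -> ~ R (fun n => e (S n)) z) _ _ _).
  - apply D1_and; [exact HR|].
    apply (D1_ball (fun e => e 0%nat) (fun e z => ~ R (fun n => e (S n)) z)); [t1|].
    apply D1_not.
    assert (H : forall P (r : nat -> nat), D1 P -> D1 (fun e => P (fun n => e (r n)))).
    { intros P r [H1 H2]; split;
        [exact (S1_inst _ (fun n => inl (r n)) H1)|exact (S1_inst _ (fun n => inl (r n)) H2)]. }
    exact (H _ (fun n => match n with 0%nat => 0%nat | S n => S (S n) end) HR).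
  - intros e. split.
    + intros He. rewrite He. apply mu_spec; [|apply Htot].
      refine (S1_inst _ (fun n => match n with 0 => inl 0%nat | S n => inr (e (S n)) end)
                (D1_S1 _ HR)).
    + intros [H L]. symmetry; apply mu_eq; assumption.
Qed.

Definition pred x := mu (fun y => x <= y + 1).

Lemma pred_succ x : pred (x + 1) = x.
Proof.
  apply mu_eq; [apply le_refl|]. intros z Hz H. apply not_lt in Hz; [assumption|].
  lin H 0.
Qed.

Lemma T1_pred : T1 (fun e => pred (e 0%nat)).
Proof.
  apply (T1_mu (fun e y => e 0%nat <= y + 1)); [d1|].
  intros e; exists (e 0%nat). lin (le_refl (e 0%nat)) 1.
Qed.

(** The alternative [y = 0] keeps the search total; it gives quotient 0 and, below, remainder [x] on
    division by zero. *)
Definition quo x y := mu (fun q => y = 0 \/ x < (q + 1) * y).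

Lemma quo_total x y : exists q, y = 0 \/ x < (q + 1) * y.
Proof.
  exists x. destruct (zero_or_succ y) as [->|[z ->]]; [auto|]. right.
  lin (le_0_l (x * z + z)) 0.
Qed.

Lemma T1_quo : T1 (fun e => quo (e 0%nat) (e 1%nat)).
Proof.
  apply (T1_mu (fun e q => e 1%nat = 0 \/ e 0%nat < (q + 1) * e 1%nat)); [d1|].
  intros e; apply quo_total.
Qed.

Lemma quo_mul_le x y : quo x y * y <= x.
Proof.
  destruct (mu_spec (fun q => y = 0 \/ x < (q + 1) * y)) as [_ H]; [s1|apply quo_total|].
  fold (quo x y) in H. destruct (zero_or_succ (quo x y)) as [E|[q E]].
  - rewrite E. lin (le_0_l x) 0.
  - apply not_lt. intros L. apply (H q); rewrite E in *; [apply le_refl|right; exact L].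
Qed.

Definition rem x y := mu (fun r => x <= quo x y * y + r).

Lemma T1_rem : T1 (fun e => rem (e 0%nat) (e 1%nat)).
Proof.
  assert (H := T1_quo).
  apply (T1_mu (fun e r => e 0%nat <= quo (e 0%nat) (e 1%nat) * e 1%nat + r)); [d1|].
  intros e. exists (e 0%nat). lin (le_0_l (quo (e 0%nat) (e 1%nat) * e 1%nat)) 0.
Qed.

Lemma quo_rem x y : x = quo x y * y + rem x y.
Proof.
  destruct (proj1 (le_iff _ _) (quo_mul_le x y)) as [r Hr].
  replace (rem x y) with r; [exact Hr|]. symmetry. apply mu_eq; rewrite <- ?Hr.
  - apply le_refl.
  - intros z Hz H. rewrite Hr in H at 1.
    apply (lt_irrefl z). lin (H, Hz) 0.
Qed.

Lemma rem_lt x y : 0 < y -> rem x y < y.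
Proof.
  intros Hy. destruct (mu_spec (fun q => y = 0 \/ x < (q + 1) * y)) as [[H|H] _];
    [s1|apply quo_total|rewrite H in Hy; destruct (lt_irrefl _ Hy)|].
  fold (quo x y) in H. rewrite (quo_rem x y) in H at 1. lin H 0.
Qed.

Lemma quo_unique x y q r : x = q * y + r -> r < y -> quo x y = q.
Proof.
  intros E Hr. apply mu_eq.
  - right. rewrite E. lin Hr 0.
  - intros z Hz [H|H]; [rewrite H in Hr; exact (nlt_0_r _ Hr)|].
    apply (lt_irrefl x). assert (L := le_mul _ _ _ _ (lt_le _ _ Hz) (le_refl y)).
    assert (M := eq_ge _ _ E). lin (H, L, M) r.
Qed.

Lemma rem_unique x y q r : x = q * y + r -> r < y -> rem x y = r.
Proof.
  intros E Hr. assert (Q := quo_unique _ _ _ _ E Hr). assert (H := quo_rem x y).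
  rewrite Q, E in H at 1. apply add_cancel_l in H. rewrite E; congruence.
Qed.

Lemma rem_le x y : rem x y <= x.
Proof. assert (H := quo_rem x y). assert (L := eq_ge _ _ H). lin L (quo x y * y). Qed.

Lemma rem_add_mul x y k : 0 < y -> rem (x + y * k) y = rem x y.
Proof.
  intros Hy. apply (rem_unique _ _ (quo x y + k)); [|apply rem_lt, Hy].
  rewrite (quo_rem x y) at 1. ring.
Qed.

(** The moduli of Goedel's beta function. Those with indices [i] and [j] are coprime when [m] is
    divisible by the distance of [i] and [j]. *)
Definition modulus m i := (i + 1) * m + 1.

Lemma modulus_pos m i : 0 < modulus m i.
Proof. apply le_0_l. Qed.

Definition beta c m i := rem c (modulus m i).

Lemma T1_beta : T1 (fun e => beta (e 0%nat) (e 1%nat) (e 2%nat)).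
Proof.
  assert (H := T1_rem). unfold beta, modulus. t1.
Qed.

Definition invertible_mod q p := exists a b, q * a = 1 + p * b.

Lemma moduli_invertible m i j k l : j = i + k -> m = k * l ->
  invertible_mod (modulus m i) (modulus m j).
Proof.
  intros -> ->.
  (* Let [q] and [p] be the moduli of [i] and [j = i + k]. From [(j + 1) * q = (i + 1) * p + k], the
     number [k] is [(j + 1) * q] modulo [p]. Inserting this into [q = 1 + (i + 1) * l * k] shows
     that [1 - (i + 1) * l * (j + 1)] inverts [q]. The sign is removed by writing -1 as
     [(j + 1) * m], to which it is congruent modulo [p]. *)
  exists (1 + (i + 1) * l * (i + k + 1) * ((i + k + 1) * (k * l))),
    ((i + 1) * l * (k + (i + 1) * (k * l) * (i + k + 1))).
  unfold modulus; ring.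
Qed.

Lemma invertible_mul p q q' :
  invertible_mod q p -> invertible_mod q' p -> invertible_mod (q * q') p.
Proof.
  intros [a [b H]] [a' [b' H']]. exists (a * a'), (b + b' + p * b * b').
  transitivity ((q * a) * (q' * a')); [ring|]. rewrite H, H'. ring.
Qed.

Lemma crt_step P q c y : invertible_mod P q -> 0 < q ->
  exists t s, c + P * t = y + q * s.
Proof.
  intros [a [b H]] Hq.
  destruct (zero_or_succ q) as [->|[r ->]]; [destruct (lt_irrefl _ Hq)|].
  (* The inverse [a] has to be multiplied by [y - c]; modulo [q = r + 1] this is [y + c * r]. *)
  exists (a * (y + c * r)), (c + b * (y + c * r)).
  transitivity (c + (P * a) * (y + c * r)); [ring|]. rewrite H. ring.
Qed.

Lemma common_multiple n a : exists m, a <= m /\ forall k, k < n + 1 -> 0 < k -> exists l, m = k * l.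
Proof.
  revert n. match goal with |- forall n, @?P n => apply (S1_induction P) end.
  - apply (S1_ex (fun e m => a <= m /\ forall k, k < e 0%nat + 1 -> 0 < k -> exists l, m = k * l)).
    apply S1_and; [s1|]. s1.
  - exists a; split; [apply le_refl|]. intros k Hk H. apply lt_succ_r in Hk as [Hk| ->].
    + destruct (nlt_0_r _ Hk).
    + destruct (lt_irrefl _ H).
  - intros n [m [Ha H]]. exists (m * (n + 1)). split.
    + apply (le_trans _ _ _ Ha). lin (le_0_l (m * n)) 0.
    + intros k Hk H0. apply lt_succ_r in Hk as [Hk| ->].
      * destruct (H k Hk H0) as [l ->]. exists (l * (n + 1)); ring.
      * exists m; ring.
Qed.

(** Chinese remaindering, one modulus at a time. [P] is a common multiple of the moduli already
    treated and invertible modulo the remaining ones, so adding a multiple of [P] to [c] sets the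
    next remainder and disturbs none of the earlier. Since [m] is at least the bound [b], every
    value is smaller than its modulus. *)
Lemma beta_exists (s : num -> num) n b : T1 (fun e => s (e 0%nat)) ->
  (forall i, i < n -> s i <= b) -> exists c m, forall i, i < n -> beta c m i = s i.
Proof.
  intros Hs Hb. destruct (common_multiple n b) as [m [Hbm Hm]].
  enough (H : forall j, exists c P, j <= n ->
     (forall i, i < j -> beta c m i = s i /\ exists l, P = modulus m i * l)
     /\ (forall i, i < n -> j <= i -> invertible_mod P (modulus m i))).
  { destruct (H n) as [c [P HP]]. exists c, m. intros i Hi.
    apply (proj1 (HP (le_refl n))), Hi. }
  match goal with |- forall n, @?P n => apply (S1_induction P) end.
  - assert (H := T1_beta). unfold invertible_mod. unfold modulus. s1.
  - exists 0, 1. intros _; split; [intros i Hi; destruct (nlt_0_r _ Hi)|].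
    intros i _ _. exists 1, 0. ring.
  - intros j [c [P IH]].
    destruct (classic (j < n)) as [Hj|Hj];
      [|exists 0, 0; intros H; destruct Hj; lin H 0].
    destruct (IH (lt_le_incl _ _ Hj)) as [H1 H2].
    destruct (crt_step P (modulus m j) c (s j) (H2 j Hj (le_refl j)) (modulus_pos m j))
      as [t [u Htu]].
    exists (c + P * t), (P * modulus m j). intros _; split.
    + intros i Hi. apply lt_succ_r in Hi as [Hi| ->].
      * destruct (H1 i Hi) as [Hc [l ->]]. split; [|exists (l * modulus m j); ring].
        rewrite <- Hc. unfold beta. rewrite <- mul_assoc. apply rem_add_mul, modulus_pos.
      * split; [|exists P; ring]. unfold beta. apply (rem_unique _ _ u).
        -- rewrite Htu; ring.
        -- unfold modulus. assert (H := Hb j Hj). lin (H, Hbm) (j * m).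
    + intros i Hi Hji. apply invertible_mul; [apply H2; [exact Hi|lin Hji 1]|].
      destruct (proj1 (le_iff _ _) Hji) as [k Hk].
      destruct (Hm (k + 1)) as [l Hl].
      * assert (L := eq_ge _ _ Hk). lin (L, Hi) (j + 1).
      * apply le_0_l.
      * apply (moduli_invertible m j i (k + 1) l); [rewrite Hk; ring|exact Hl].
Qed.

(** Course-of-values recursion: [Phi p c m n] is the value at [n], computed from
    the earlier values [beta c m j], [j < n]. *)
Section CourseOfValues.
Variable Phi : num -> num -> num -> num -> num.
Hypothesis T1_Phi : T1 (fun e => Phi (e 0%nat) (e 1%nat) (e 2%nat) (e 3%nat)).
Hypothesis Phi_ext : forall p c m c' m' n,
  (forall j, j < n -> beta c m j = beta c' m' j) -> Phi p c m n = Phi p c' m' n.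

Definition history p c m n := forall i, i < n -> beta c m i = Phi p c m i.

Lemma T1_app4 (F : num -> num -> num -> num -> num) f g h k :
  T1 (fun e => F (e 0%nat) (e 1%nat) (e 2%nat) (e 3%nat)) ->
  T1 f -> T1 g -> T1 h -> T1 k -> T1 (fun e => F (f e) (g e) (h e) (k e)).
Proof.
  intros HF Hf Hg Hh Hk.
  refine (S1_subst (fun e => e 1%nat = F (f (fun n => e (S (S n)))) (g (fun n => e (S (S n))))
             (h (fun n => e (S (S n)))) (e 0%nat))
            (fun e => k (fun n => e (S n))) _ (T1_shift _ Hk)).
  refine (S1_subst (fun e => e 2%nat = F (f (fun n => e (S (S (S n))))) (g (fun n => e (S (S (S n)))))
             (e 0%nat) (e 1%nat))
            (fun e => h (fun n => e (S (S n)))) _ (T1_shift _ (T1_shift _ Hh))).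
  refine (S1_subst (fun e => e 3%nat = F (f (fun n => e (S (S (S (S n)))))) (e 0%nat) (e 1%nat) (e 2%nat))
            (fun e => g (fun n => e (S (S (S n))))) _ (T1_shift _ (T1_shift _ (T1_shift _ Hg)))).
  refine (S1_subst (fun e => e 4%nat = F (e 0%nat) (e 1%nat) (e 2%nat) (e 3%nat))
            (fun e => f (fun n => e (S (S (S (S n)))))) _
            (T1_shift _ (T1_shift _ (T1_shift _ (T1_shift _ Hf))))).
  exact (S1_inst _ (fun n => match n with 0%nat => inl 4%nat | S n => inl n end) HF).
Qed.

Lemma history_exists p n : exists c m, history p c m n.
Proof.
  assert (Hb := T1_beta). unfold history. revert n.
  match goal with |- forall n, @?P n => apply (S1_induction P) end.
  - s1. apply (T1_app4 Phi); [exact T1_Phi|t1|t1|t1|t1].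
  - exists 0, 0. intros i Hi; destruct (nlt_0_r _ Hi).
  - intros n [c [m H]].
    pose (s := fun i => ite (i < n) (beta c m i) (Phi p c m n)).
    destruct (beta_exists s (n + 1) (c + Phi p c m n)) as [c' [m' H']].
    + unfold s; t1.
    + intros i _. unfold s.
      destruct (classic (i < n)); [rewrite ite_true by assumption|rewrite ite_false by assumption].
      * assert (L := rem_le c (modulus m i)). fold (beta c m i) in L. lin L (Phi p c m n).
      * lin (le_0_l c) 0.
    + exists c', m'. intros i Hi. rewrite H' by assumption.
      apply lt_succ_r in Hi as [Hi| ->]; unfold s.
      * rewrite ite_true, H by assumption. apply Phi_ext. intros j Hj.
        rewrite H' by (apply lt_succ_r; left; exact (lt_trans _ _ _ Hj Hi)).
        unfold s; rewrite ite_true; [reflexivity|exact (lt_trans _ _ _ Hj Hi)].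
      * rewrite ite_false by apply lt_irrefl. apply Phi_ext. intros j Hj.
        rewrite H' by (apply lt_succ_r; left; exact Hj).
        unfold s; rewrite ite_true; [reflexivity|exact Hj].
Qed.

Lemma strong_induction (P : num -> Prop) : D1 (fun e => P (e 0%nat)) ->
  (forall n, (forall i, i < n -> P i) -> P n) -> forall n, P n.
Proof.
  intros HP H n.
  enough (L : forall n, forall i, i < n -> P i) by (apply (L (n + 1)), le_refl).
  match goal with |- forall n, @?P n => apply (S1_induction P) end.
  - s1.
  - intros i Hi; destruct (nlt_0_r _ Hi).
  - intros k IH i Hi. apply lt_succ_r in Hi as [Hi| ->]; auto.
Qed.

Lemma history_unique p c m n c' m' n' i :
  history p c m n -> history p c' m' n' -> i < n -> i < n' -> beta c m i = beta c' m' i.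
Proof.
  assert (Hb := T1_beta). intros H H'. revert i.
  match goal with |- forall n, @?P n => apply (strong_induction P) end; [d1|].
  intros i IH Hi Hi'. rewrite H, H' by assumption. apply Phi_ext. intros j Hj.
  apply IH; [exact Hj|exact (lt_trans _ _ _ Hj Hi)|exact (lt_trans _ _ _ Hj Hi')].
Qed.

(** The value at [n] is read off from any history that reaches [n]. Histories agree where they
    overlap, so the graph of [G] is Sigma_1. *)
Lemma course_of_values : exists G : num -> num -> num,
  T1 (fun e => G (e 0%nat) (e 1%nat)) /\
  forall p n, exists c m, (forall i, i < n -> beta c m i = G p i) /\ G p n = Phi p c m n.
Proof.
  assert (Hb := T1_beta).
  pose (R p n y := exists c m, history p c m (n + 1) /\ y = beta c m n).
  assert (HR : forall p n y y', R p n y -> R p n y' -> y = y').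
  { intros p n y y' [c [m [H ->]]] [c' [m' [H' ->]]].
    apply (history_unique p _ _ _ _ _ _ _ H H'); apply le_refl. }
  pose (G p n := epsilon (inhabits 0) (R p n)).
  assert (HG : forall p n, R p n (G p n)).
  { intros p n. apply epsilon_spec. destruct (history_exists p (n + 1)) as [c [m H]].
    exists (beta c m n), c, m; auto. }
  exists G; split.
  - apply (S1_ext (fun e => R (e 1%nat) (e 2%nat) (e 0%nat))).
    + unfold R, history. s1. apply (T1_app4 Phi); [exact T1_Phi|t1|t1|t1|t1].
    + intros e; split; [intros ->; apply HG|]. intros H; exact (HR _ _ _ _ H (HG _ _)).
  - intros p n. destruct (HG p n) as [c [m [H E]]]. exists c, m.
    assert (L : forall i, i < n -> beta c m i = G p i).
    { intros i Hi. destruct (HG p i) as [c' [m' [H' ->]]].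
      apply (history_unique p _ _ _ _ _ _ _ H H'); [|apply le_refl].
      apply lt_succ_r; left; exact Hi. }
    split; [exact L|]. rewrite E. apply H, le_refl.
Qed.

End CourseOfValues.

Lemma primitive_recursion (a : num -> num) (F : num -> num -> num -> num) :
  T1 (fun e => a (e 0%nat)) -> T1 (fun e => F (e 0%nat) (e 1%nat) (e 2%nat)) ->
  exists G : num -> num -> num, T1 (fun e => G (e 0%nat) (e 1%nat)) /\
    forall p, G p 0 = a p /\ forall n, G p (n + 1) = F p n (G p n).
Proof.
  intros Ha HF. assert (Hb := T1_beta). assert (Hp := T1_pred).
  pose (Phi p c m n := ite (n = 0) (a p) (F p (pred n) (beta c m (pred n)))).
  destruct (course_of_values Phi) as [G [HG H]].
  - unfold Phi; t1.
  - intros p c m c' m' n E. unfold Phi.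
    destruct (zero_or_succ n) as [->|[k ->]]; [rewrite !ite_true by reflexivity; reflexivity|].
    rewrite !ite_false by apply succ_neq_0. rewrite pred_succ, E; [reflexivity|apply le_refl].
  - exists G; split; [exact HG|]. intros p; split.
    + destruct (H p 0) as [c [m [_ ->]]]. apply ite_true; reflexivity.
    + intros n. destruct (H p (n + 1)) as [c [m [L ->]]].
      unfold Phi. rewrite ite_false by apply succ_neq_0.
      rewrite pred_succ, L; [reflexivity|apply le_refl].
Qed.

Lemma primitive_recursion0 (a : num) (F : num -> num -> num) :
  T1 (fun e => F (e 0%nat) (e 1%nat)) ->
  exists G : num -> num, T1 (fun e => G (e 0%nat)) /\
    G 0 = a /\ forall n, G (n + 1) = F n (G n).
Proof.
  intros HF. destruct (primitive_recursion (fun _ => a) (fun _ => F)) as [G [HG H]]; [t1|t1|].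
  exists (G 0). split; [t1|apply H].
Qed.

End Recursion.

#[export] Hint Resolve T1_pred T1_quo T1_rem T1_beta : rec.

Ltac induct := match goal with |- forall n, @?P n => apply (S1_induction P); [s1| |] end;
  cbn beta.

(** * Powers and expansions in base 3 *)

Section Powers.
Context {K : RCA0_model}.
Open Scope model_scope.
Notation env := (nat -> num).
Add Ring num_ring : num_semi_ring.

Lemma power_exists : exists G : num -> num -> num, T1 (fun e => G (e 0%nat) (e 1%nat)) /\
  forall b, G b 0 = 1 /\ forall n, G b (n + 1) = G b n * b.
Proof. apply (primitive_recursion (fun _ => 1) (fun b _ y => y * b)); t1. Qed.

Definition pw : num -> num -> num :=
  proj1_sig (constructive_indefinite_description _ power_exists).

Lemma T1_pw : T1 (fun e => pw (e 0%nat) (e 1%nat)).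
Proof. exact (proj1 (proj2_sig (constructive_indefinite_description _ power_exists))). Qed.
Hint Resolve T1_pw : rec.

Lemma pw_0 b : pw b 0 = 1.
Proof. exact (proj1 (proj2 (proj2_sig (constructive_indefinite_description _ power_exists)) b)). Qed.

Lemma pw_succ b n : pw b (n + 1) = pw b n * b.
Proof. exact (proj2 (proj2 (proj2_sig (constructive_indefinite_description _ power_exists)) b) n). Qed.

Lemma pw_add b m n : pw b (m + n) = pw b m * pw b n.
Proof.
  revert n; induct; [rewrite add_0_r, pw_0; ring|].
  intros n IH. rewrite add_assoc, !pw_succ, IH. ring.
Qed.

Lemma lt_0_1 : 0 < 1.
Proof. apply lt_1_r; reflexivity. Qed.

Lemma mul_pos x y : 0 < x -> 0 < y -> 0 < x * y.
Proof.
  destruct (zero_or_succ x) as [->|[u ->]]; [intros H; destruct (lt_irrefl _ H)|].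
  destruct (zero_or_succ y) as [->|[v ->]]; [intros _ H; destruct (lt_irrefl _ H)|].
  intros _ _. lin (le_0_l (u * v + u + v)) 0.
Qed.

Lemma pw_pos b n : 0 < b -> 0 < pw b n.
Proof.
  intros Hb. revert n; induct; [rewrite pw_0; apply lt_0_1|].
  intros n IH. rewrite pw_succ. apply mul_pos; assumption.
Qed.

Lemma pw_le b m n : 0 < b -> m <= n -> pw b m <= pw b n.
Proof.
  intros Hb H. apply le_iff in H as [k ->]. rewrite pw_add.
  assert (L := le_mul _ _ _ _ (le_refl (pw b m)) (lt_le _ _ (pw_pos b k Hb))).
  lin L 0.
Qed.

Lemma lt_pw b n : 1 < b -> n < pw b n.
Proof.
  intros Hb. revert n; induct; [rewrite pw_0; apply lt_0_1|].
  intros n IH. rewrite pw_succ.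
  assert (L := le_mul _ _ _ _ (lt_le _ _ IH) (lt_le _ _ Hb)). lin L n.
Qed.

Lemma quo_lt_mono x y z : 0 < z -> quo x z < quo y z -> x < y.
Proof.
  intros Hz H. assert (L := le_mul _ _ _ _ (lt_le _ _ H) (le_refl z)).
  assert (Lx := rem_lt x z Hz). assert (Ex := eq_le _ _ (quo_rem x z)).
  assert (Ey := eq_ge _ _ (quo_rem y z)). lin (L, Lx, Ex, Ey) (rem y z).
Qed.

Lemma quo_quo x y z : 0 < y -> 0 < z -> quo (quo x y) z = quo x (y * z).
Proof.
  intros Hy Hz. symmetry.
  apply (quo_unique _ _ _ (rem (quo x y) z * y + rem x y)).
  - rewrite (quo_rem x y) at 1. rewrite (quo_rem (quo x y) z) at 1. ring.
  - assert (L := le_mul _ _ _ _ (lt_le _ _ (rem_lt (quo x y) z Hz)) (le_refl y)).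
    assert (L' := rem_lt x y Hy). lin (L, L') 0.
Qed.

Lemma quo_add_mul x y k : 0 < y -> quo (x + y * k) y = quo x y + k.
Proof.
  intros Hy. apply (quo_unique _ _ _ (rem x y)); [|apply rem_lt, Hy].
  rewrite (quo_rem x y) at 1. ring.
Qed.

Lemma quo_small x y : x < y -> quo x y = 0.
Proof. intros H. apply (quo_unique _ _ _ x); [ring|exact H]. Qed.

Lemma rem_small x y : x < y -> rem x y = x.
Proof. intros H. apply (rem_unique _ _ 0); [ring|exact H]. Qed.

Lemma quo_eq_0 x y : 0 < y -> quo x y = 0 -> x < y.
Proof.
  intros Hy H. rewrite (quo_rem x y), H. assert (L := rem_lt x y Hy). lin L 0.
Qed.

Lemma quo_1 x : quo x 1 = x.
Proof. apply (quo_unique _ _ _ 0); [ring|apply lt_0_1]. Qed.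

Definition three : num := 1 + 1 + 1.

Lemma three_pos : 0 < three.
Proof. apply le_0_l. Qed.

Lemma one_lt_three : 1 < three.
Proof. unfold three. lin (le_refl 0) 1. Qed.

Lemma pw_three_succ n : pw three (n + 1) = pw three n + pw three n + pw three n.
Proof. rewrite pw_succ. unfold three at 2. ring. Qed.

(** The exponent of 3 in [z], junk value [0] at [z = 0]. *)
Definition low z := mu (fun n => z = 0 \/ rem z (pw three (n + 1)) <> 0).

(** The lowest nonzero digit of [z] in base 3. *)
Definition digit z := rem (quo z (pw three (low z))) three.

(** The exponent of the largest power of 3 below [z], junk value [0] at [z = 0]. *)
Definition top z := mu (fun n => z < pw three (n + 1)).

Lemma low_total z : exists n, z = 0 \/ rem z (pw three (n + 1)) <> 0.
Proof.
  exists z. destruct (classic (z = 0)) as [|H]; [auto|]. right.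
  rewrite rem_small; [exact H|].
  assert (L := lt_pw three (z + 1) one_lt_three). lin L 1.
Qed.

Lemma T1_low : T1 (fun e => low (e 0%nat)).
Proof.
  apply (T1_mu (fun e n => e 0%nat = 0 \/ rem (e 0%nat) (pw three (n + 1)) <> 0)); [d1|].
  intros e; apply low_total.
Qed.
Hint Resolve T1_low : rec.

Lemma T1_digit : T1 (fun e => digit (e 0%nat)).
Proof. unfold digit; t1. Qed.

Lemma top_total z : exists n, z < pw three (n + 1).
Proof.
  exists z. assert (L := lt_pw three (z + 1) one_lt_three). lin L 1.
Qed.

Lemma T1_top : T1 (fun e => top (e 0%nat)).
Proof.
  apply (T1_mu (fun e n => e 0%nat < pw three (n + 1))); [d1|].
  intros e; apply top_total.
Qed.

Lemma top_lt z : z < pw three (top z + 1).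
Proof. apply (mu_spec (fun n => z < pw three (n + 1))); [s1|apply top_total]. Qed.

Lemma top_le z : 0 < z -> pw three (top z) <= z.
Proof.
  intros Hz. destruct (mu_spec (fun n => z < pw three (n + 1))) as [_ H]; [s1|apply top_total|].
  fold (top z) in H. destruct (zero_or_succ (top z)) as [->|[n E]].
  - rewrite pw_0. lin Hz 0.
  - rewrite E in *. apply not_lt, H, le_refl.
Qed.

Lemma top_unique z n : pw three n <= z -> z < pw three (n + 1) -> top z = n.
Proof.
  intros H1 H2. apply mu_eq; [exact H2|]. intros m Hm H.
  assert (L := pw_le three (m + 1) n three_pos (lt_le _ _ Hm)).
  apply (lt_irrefl z). lin (H, L, H1) 0.
Qed.

Lemma top_mono x y : x <= y -> top x <= top y.
Proof.
  intros H. apply not_lt. intros L.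
  destruct (mu_spec (fun n => x < pw three (n + 1))) as [_ N]; [s1|apply top_total|].
  apply (N (top y)); [exact L|]. exact (le_lt_trans _ _ _ H (top_lt y)).
Qed.

Lemma top_add_le x y : x < y -> top (x + y) <= top y + 1.
Proof.
  intros H. apply not_lt. intros L.
  destruct (mu_spec (fun n => x + y < pw three (n + 1))) as [_ N]; [s1|apply top_total|].
  apply (N (top y + 1)); [exact L|]. rewrite pw_three_succ.
  assert (L1 := top_lt y).
  lin (H, L1, L1) (pw three (top y + 1) + 1 + 1).
Qed.

Lemma digit_cases z : 0 < z -> exists k, z = pw three (low z) * (three * k + digit z) /\
  (digit z = 1 \/ digit z = 1 + 1).
Proof.
  intros Hz. set (n := low z).
  destruct (mu_spec (fun n => z = 0 \/ rem z (pw three (n + 1)) <> 0)) as [[H|H] N];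
    [s1|apply low_total|rewrite H in Hz; destruct (lt_irrefl _ Hz)|].
  fold (low z) in H, N. fold n in H, N.
  assert (Hp := pw_pos three n three_pos).
  assert (E : rem z (pw three n) = 0).
  { destruct (zero_or_succ n) as [->|[m Em]].
    - rewrite pw_0. apply lt_1_r, rem_lt, lt_0_1.
    - apply NNPP; intros L. apply (N m); [rewrite Em; apply le_refl|].
      right; rewrite <- Em; exact L. }
  assert (Ez := quo_rem z (pw three n)). rewrite E in Ez.
  assert (Eq := quo_rem (quo z (pw three n)) three). fold n in Eq.
  change (rem (quo z (pw three n)) three) with (digit z) in Eq.
  exists (quo (quo z (pw three n)) three). split.
  - rewrite Ez at 1. rewrite Eq at 1. ring.
  - assert (L := rem_lt (quo z (pw three n)) three three_pos).
    change (rem (quo z (pw three n)) three) with (digit z) in L.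
    unfold three in L.
    apply lt_succ_r in L as [L|L]; [|auto]. apply lt_succ_r in L as [L|L]; [|auto].
    apply lt_1_r in L. destruct H. rewrite pw_succ.
    apply (rem_unique _ _ (quo (quo z (pw three n)) three)).
    + rewrite Ez at 1. rewrite Eq at 1. rewrite L. ring.
    + apply mul_pos; [exact Hp|exact three_pos].
Qed.

Lemma low_digit_unique z n k d : z = pw three n * (three * k + d) -> d = 1 \/ d = 1 + 1 ->
  low z = n /\ digit z = d.
Proof.
  intros Ez Hd.
  assert (Hp := fun n => pw_pos three n three_pos).
  assert (Hd0 : 0 < d) by (destruct Hd as [-> | ->]; [apply lt_0_1|lin (le_refl 0) 1]).
  assert (Hd3 : d < three) by (unfold three; destruct Hd as [-> | ->];
    [lin (le_refl 0) 1|lin (le_refl 0) 0]).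
  assert (El : low z = n).
  { apply mu_eq.
    - right. rewrite pw_succ, (rem_unique _ _ k (pw three n * d)).
      + apply pos_iff, mul_pos; [apply Hp|exact Hd0].
      + rewrite Ez; ring.
      + assert (L := le_mul _ _ _ _ (le_refl (pw three n)) (lt_le _ _ Hd3)).
        assert (L' := lt_le _ _ (Hp n)). lin (L, L') 0.
    - intros m Hm [H|H].
      + assert (L : 0 < z); [|rewrite H in L; exact (lt_irrefl _ L)].
        rewrite Ez. apply mul_pos; [apply Hp|]. lin Hd0 (three * k).
      + apply H. destruct (proj1 (le_iff _ _) (lt_le _ _ Hm)) as [j Ej].
        apply (rem_unique _ _ (pw three j * (three * k + d))); [|apply Hp].
        rewrite Ez, Ej, pw_add; ring. }
  split; [exact El|]. unfold digit. rewrite El.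
  rewrite (quo_unique z (pw three n) (three * k + d) 0); [|rewrite Ez; ring|apply Hp].
  apply (rem_unique _ _ k); [ring|exact Hd3].
Qed.

(** 1 + 1 is the digit 2, and 2 + 2 is the digit 1 with a carry into the next position; neither sum
    creates a zero digit. *)
Lemma low_add_same x y : 0 < x -> 0 < y -> low x = low y -> digit x = digit y ->
  low (x + y) = low y /\ (digit (x + y) = 1 <-> digit y <> 1).
Proof.
  intros Hx Hy El Ed.
  destruct (digit_cases x Hx) as [k [Ex _]]. destruct (digit_cases y Hy) as [l [Ey Hd]].
  rewrite El, Ed in Ex.
  assert (N : 1 + 1 <> 1) by (intros N; apply (lt_irrefl 1); rewrite <- N at 2; apply le_refl).
  destruct Hd as [Hd|Hd]; rewrite Hd in *.
  - destruct (low_digit_unique (x + y) (low y) (k + l) (1 + 1)) as [L D]; [|auto|].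
    + rewrite (f_equal2 (s_add model) Ex Ey). ring.
    + split; [exact L|]. rewrite D; tauto.
  - destruct (low_digit_unique (x + y) (low y) (k + l + 1) 1) as [L D]; [|auto|].
    + rewrite (f_equal2 (s_add model) Ex Ey). unfold three. ring.
    + split; [exact L|]. rewrite D; tauto.
Qed.

Lemma low_add_lt x y : 0 < x -> 0 < y -> low x < low y ->
  low (x + y) = low x /\ digit (x + y) = digit x.
Proof.
  intros Hx Hy H.
  destruct (digit_cases x Hx) as [k [Ex Hd]]. destruct (digit_cases y Hy) as [l [Ey _]].
  apply lt_iff in H as [j Ej].
  apply (low_digit_unique _ _ (k + pw three j * (three * l + digit y))); [|exact Hd].
  rewrite (f_equal2 (s_add model) Ex Ey). rewrite Ej, pw_succ, pw_add. ring.
Qed.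

Lemma low_le_top z : 0 < z -> low z <= top z.
Proof.
  intros Hz. apply not_lt; intros H. apply (lt_irrefl z).
  apply (lt_le_trans _ _ _ (top_lt z)).
  apply (le_trans _ (pw three (low z))); [apply (pw_le _ _ _ three_pos (lt_le _ _ H))|].
  destruct (digit_cases z Hz) as [k [Ez Hd]].
  assert (L : 1 <= three * k + digit z) by
    (destruct Hd as [-> | ->]; [lin (le_0_l (three * k)) 0|lin (le_0_l (three * k)) 1]).
  rewrite Ez at 2. assert (M := le_mul _ _ _ _ (le_refl (pw three (low z))) L).
  lin M 0.
Qed.

(** [y] and the next power of 3 above it are both multiples of [P], the power of 3 at [low y], so
    they differ by at least [P]; and [x] is smaller than [P]. *)
Lemma top_add_apart x y : 0 < y -> top x < low y -> top (x + y) = top y.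
Proof.
  intros Hy H. apply top_unique.
  - apply (le_trans _ _ _ (top_le y Hy)). lin (le_0_l x) 0.
  - destruct (digit_cases y Hy) as [k [Ey _]].
    destruct (proj1 (le_iff _ _) (low_le_top y Hy)) as [j Ej].
    set (P := pw three (low y)) in *.
    assert (E : pw three (top y + 1) = P * (pw three (j + 1)))
      by (rewrite Ej, <- add_assoc, pw_add; reflexivity).
    assert (Hq : three * k + digit y < pw three (j + 1)).
    { apply not_le. intros N. assert (L := le_mul _ _ _ _ (le_refl P) N).
      rewrite <- E, <- Ey in L. exact (lt_irrefl _ (le_lt_trans _ _ _ L (top_lt y))). }
    assert (L := le_mul _ _ _ _ (le_refl P) (lt_le _ _ Hq)).
    assert (Hx := top_lt x). assert (Hxl := pw_le three _ _ three_pos (lt_le _ _ H)).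
    fold P in Hxl. assert (E' := eq_ge _ _ E). assert (E2 := eq_le _ _ Ey).
    lin (L, Hx, Hxl, E', E2) 0.
Qed.

End Powers.

#[export] Hint Resolve T1_pw T1_low T1_digit T1_top : rec.

(** * Stable colourings *)

Section Combinatorics.
Context {K : RCA0_model}.
Open Scope model_scope.
Notation env := (nat -> num).
Add Ring num_ring : num_semi_ring.

(** To be read with [P] and [Q] saying that the lowest digit is 1 and [U] and [V] being values of
    [d]: equal colours with opposite digits force opposite values. *)
Lemma flipped_iff (P Q U V : Prop) :
  (P <-> ~ Q) -> ((P <-> U) <-> (Q <-> V)) -> (U <-> ~ V).
Proof. destruct (classic Q), (classic U); tauto. Qed.

(* Counting the [i < b] witnessed below [c] and maximizing the count over [c]. *)
Lemma strong_bounding (R : num -> num -> Prop) b : D1 (fun e => R (e 0%nat) (e 1%nat)) ->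
  exists c, forall i, i < b -> (exists x, R i x) -> exists x, x < c /\ R i x.
Proof.
  intros HR.
  destruct (primitive_recursion (fun _ => 0) (fun c k y => y + ite (exists x, x < c /\ R k x) 1 0))
    as [G [HG H]]; [t1|t1|].
  assert (Hite : forall P, ite P 1 0 <= 1).
  { intros P. unfold ite; destruct excluded_middle_informative;
      [lin (le_refl 0) 0|lin (le_refl 0) 1]. }
  assert (Hle : forall c k, G c k <= k).
  { intros c. induct; [rewrite (proj1 (H c)); apply le_refl|].
    intros k IH. rewrite (proj2 (H c)). lin (IH, Hite (exists x, x < c /\ R k x)) 0. }
  assert (Hmono : forall c c', c <= c' -> forall k, G c k <= G c' k /\
      ((exists i, i < k /\ ~ (exists x, x < c /\ R i x) /\ exists x, x < c' /\ R i x) ->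
        G c k < G c' k)).
  { intros c c' Hc. induct.
    - rewrite !(proj1 (H _)); split; [apply le_refl|]. intros [i [Hi _]]; destruct (nlt_0_r _ Hi).
    - intros k [IH1 IH2]. rewrite !(proj2 (H _)).
      assert (L : (exists x, x < c /\ R k x) -> exists x, x < c' /\ R k x)
        by (intros [x [Hx Hr]]; exists x; split; [exact (lt_le_trans _ _ _ Hx Hc)|exact Hr]).
      destruct (classic (exists x, x < c /\ R k x)) as [E|E];
        [rewrite (ite_true _ _ _ E), (ite_true _ _ _ (L E))|rewrite (ite_false _ _ _ E)].
      + split; [lin IH1 0|]. intros [i [Hi [N1 N2]]].
        apply lt_succ_r in Hi as [Hi| ->]; [|contradiction].
        assert (IH := IH2 (ex_intro _ i (conj Hi (conj N1 N2)))). lin IH 0.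
      + destruct (classic (exists x, x < c' /\ R k x)) as [E'|E'];
          [rewrite (ite_true _ _ _ E')|rewrite (ite_false _ _ _ E')].
        * split; [lin IH1 1|]. intros _. lin IH1 0.
        * split; [lin IH1 0|]. intros [i [Hi [N1 N2]]].
          apply lt_succ_r in Hi as [Hi| ->]; [|contradiction].
          assert (IH := IH2 (ex_intro _ i (conj Hi (conj N1 N2)))). lin IH 0. }
  destruct (S1_greatest (fun v => exists c, v = G c b) (G 0 b) b) as [v [[c ->] Hc]].
  - s1.
  - intros x [c ->]; apply Hle.
  - exists 0; reflexivity.
  - exists c. intros i Hi [x Hx]. apply NNPP; intros N.
    assert (L : c <= c + x + 1) by lin (le_0_l x) 1.
    apply (lt_irrefl (G c b)).
    apply (lt_le_trans _ (G (c + x + 1) b)); [|apply Hc; exists (c + x + 1); reflexivity].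
    apply (proj2 (Hmono _ _ L b)). exists i; split; [exact Hi|]. split; [exact N|].
    exists x; split; [lin (le_0_l c) 0|exact Hx].
Qed.

Definition infinite_in (P : num -> Prop) := forall x, exists y, x < y /\ P y.

Definition eventually (P : num -> Prop) := exists m, forall t, m < t -> P t.

Definition stable_rel (d : num -> num -> Prop) :=
  forall s, eventually (d s) \/ eventually (fun t => ~ d s t).

Definition sum_of_two (X : set_dom model) t := t in_set X \/
  exists x y, x in_set X /\ y in_set X /\ x < y /\ t = x + y.

Definition Hindman2 := forall c : num -> Prop, D1 (fun e => c (e 0%nat)) ->
  exists X, (forall x, x in_set X -> 0 < x) /\ infinite_in (fun x => x in_set X) /\
    forall u v, sum_of_two X u -> sum_of_two X v -> (c u <-> c v).

Hypothesis HT : Hindman2.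

(** The set [A] consists of the numbers [low x] for the [x] in the solution with one fixed lowest
    digit, and is therefore only enumerable. The limits exist separately for each [a], without a
    common bound on the stages where they are reached. *)
Lemma limit_homogeneous (d : num -> num -> Prop) :
  D1 (fun e => d (e 0%nat) (e 1%nat)) -> stable_rel d ->
  exists (A : num -> Prop) (i : Prop), S1 (fun e => A (e 0%nat)) /\ infinite_in A /\
    forall a, A a -> eventually (fun t => d a t <-> i).
Proof.
  intros Hd Hst.
  destruct (HT (fun z => digit z = 1 <-> d (low z) (top z))) as [X [Hpos [Hinf HX]]]; [d1|].
  destruct (Hinf 0) as [x0 [_ Hx0]].
  set (c := fun z => digit z = 1 <-> d (low z) (top z)) in HX.
  assert (Hsum : forall x y, x in_set X -> y in_set X -> x < y -> c (x + y) <-> c y).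
  { intros x y Hx Hy L. apply HX; [right|left; exact Hy]. exists x, y; auto. }
  assert (Hunb : infinite_in (fun l => exists x, x in_set X /\ low x = l)).
  { apply NNPP; intros N.
    assert (HL : exists L, forall x, x in_set X -> low x <= L).
    { apply NNPP; intros N'. apply N. intros L. apply NNPP; intros N''. apply N'.
      exists L. intros x Hx. apply not_lt; intros H. apply N''. exists (low x); eauto. }
    destruct HL as [L HL]. clear N.
    (* A large [y] in [X] has a smaller mate [x] in [X] with the same exponent and
       digit. The sum [x + y] has the colour of [y] but the other digit, so it carries
       into a new top position, where [d (low y)] changes. Any [z] in [X] between [x]
       and [y] carries too, so [low z <= low y]. Hence [low] is eventually constant on
       [X], and these infinitely many changes contradict stability. *)
    destruct (strong_bounding (fun i x => x in_set X /\ three * low x + digit x = i)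
                (three * L + three)) as [B HB]; [d1|].
    assert (Hclass : forall y, y in_set X -> B <= y ->
       exists x, x in_set X /\ x < B /\ low x = low y /\ digit x = digit y).
    { intros y Hy HBy.
      assert (D3 : forall z, digit z < three) by (intros z; apply rem_lt, three_pos).
      (* The index codes the pair of [low y] and [digit y]. It is below [three * L + three] as
         [low y <= L], and division by 3 recovers the pair. *)
      destruct (HB (three * low y + digit y)) as [x [Hx [HxX E]]].
      - assert (M := le_mul _ _ _ _ (le_refl three) (HL y Hy)). assert (M' := D3 y).
        lin (M, M') 0.
      - exists y; auto.
      - exists x. repeat split; auto.
        + assert (Ex := quo_unique _ three (low x) (digit x) ltac:(rewrite (mul_comm (low x)); reflexivity) (D3 x)).
          assert (Ey := quo_unique _ three (low y) (digit y) ltac:(rewrite (mul_comm (low y)); reflexivity) (D3 y)).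
          congruence.
        + assert (Ex := rem_unique _ three (low x) (digit x) ltac:(rewrite (mul_comm (low x)); reflexivity) (D3 x)).
          assert (Ey := rem_unique _ three (low y) (digit y) ltac:(rewrite (mul_comm (low y)); reflexivity) (D3 y)).
          congruence. }
    assert (Hcross : forall y, y in_set X -> B <= y -> exists x, x in_set X /\ x < B /\
       top (x + y) = top y + 1 /\ (d (low y) (top y + 1) <-> ~ d (low y) (top y))).
    { intros y Hy HBy. destruct (Hclass y Hy HBy) as [x [Hx [HxB [El Ed]]]].
      assert (Hxy := lt_le_trans _ _ _ HxB HBy).
      assert (S := Hsum x y Hx Hy Hxy).
      destruct (low_add_same x y (Hpos x Hx) (Hpos y Hy) El Ed) as [El' Ed'].
      unfold c in S. rewrite El' in S.
      assert (T : top (x + y) = top y + 1).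
      { assert (T1 := top_add_le x y Hxy). apply lt_succ_r in T1 as [T1|T1]; [|exact T1].
        assert (T2 : top y <= top (x + y)) by (apply top_mono; lin (le_0_l x) 0).
        (* If [top] did not move, [d (low y) (top y)] would differ from itself. *)
        assert (S' := flipped_iff _ _ _ _ Ed' S).
        rewrite (le_antisym _ _ T1 T2) in S'. clear - S'; tauto. }
      rewrite T in S. exists x. split; [exact Hx|]. split; [exact HxB|].
      split; [exact T|]. exact (flipped_iff _ _ _ _ Ed' S). }
    assert (Hmono : forall x y, x in_set X -> y in_set X -> B <= x -> x < y -> low x <= low y).
    { intros x y Hx Hy HBx Hxy. apply not_lt; intros Hlow.
      destruct (Hcross y Hy (le_trans _ _ _ HBx (lt_le_incl _ _ Hxy))) as [z [Hz [HzB [T Hdy]]]].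
      destruct (low_add_lt y x (Hpos y Hy) (Hpos x Hx) Hlow) as [El Ed].
      assert (S := Hsum x y Hx Hy Hxy). unfold c in S.
      rewrite (add_comm x y), El, Ed, (add_comm y x) in S.
      replace (top (x + y)) with (top y + 1) in S; [clear - S Hdy; tauto|].
      apply le_antisym; [|apply top_add_le, Hxy].
      rewrite <- T. apply top_mono.
      assert (M := lt_le_incl _ _ (lt_le_trans _ _ _ HzB HBx)). lin M 0. }
    destruct (Hinf B) as [y0 [HBy0 Hy0]].
    destruct (S1_greatest (fun l => exists x, x in_set X /\ B <= x /\ low x = l) (low y0) L)
      as [l [[x1 [Hx1 [HBx1 El]]] Hl]]; [s1| | |].
    { intros l [x [Hx [_ <-]]]; apply HL, Hx. }
    { exists y0. repeat split; auto. apply lt_le_incl, HBy0. }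
    assert (Hm : exists m, forall t, m < t -> (d l (t + 1) <-> d l t)).
    { destruct (Hst l) as [[m Hm]|[m Hm]]; exists m; intros t Ht;
        (assert (Ht' := lt_trans _ _ _ Ht (le_refl t)));
        generalize (Hm _ Ht), (Hm _ Ht'); tauto. }
    destruct Hm as [m Hm].
    (* Beyond [x1] the value of [low] is [l], and beyond the power of 3 the value of [top] exceeds
       [m]. *)
    destruct (Hinf (x1 + pw three (m + 1))) as [y [Hy HyX]].
    assert (Hx1y : x1 < y) by lin Hy (pw three (m + 1)).
    assert (HBy : B <= y) by (apply (le_trans _ _ _ HBx1), lt_le_incl, Hx1y).
    destruct (Hcross y HyX HBy) as [z [_ [_ [_ Hdy]]]].
    assert (Ely : low y = l).
    { apply le_antisym; [apply Hl; eauto|]. rewrite <- El. apply Hmono; auto. }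
    rewrite Ely in Hdy.
    assert (Htop : m < top y); [|generalize (Hm _ Htop); tauto].
    apply not_le; intros N.
    assert (N' := pw_le three _ _ three_pos (le_add _ _ _ _ N (le_refl 1))).
    assert (M := top_lt y). assert (Q : y < x1 + pw three (m + 1)) by lin (M, N') x1.
    exact (lt_irrefl _ (lt_trans _ _ _ Q Hy)). }
  (* A pigeonhole argument with just two classes: if both were bounded, the sum of the bounds would
     bound [low] on all of [X]. *)
  assert (Hdig : exists dg, infinite_in (fun l => exists x, x in_set X /\ digit x = dg /\ low x = l)).
  { apply NNPP; intros N.
    assert (N' : forall dg, exists L, forall x, x in_set X -> digit x = dg -> low x <= L).
    { intros dg. apply NNPP; intros N'. apply N. exists dg. intros L.
      apply NNPP; intros N''. apply N'. exists L. intros x Hx Ex.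
      apply not_lt; intros H. apply N''. exists (low x); eauto 6. }
    destruct (N' 1) as [L1 H1], (N' (1 + 1)) as [L2 H2].
    destruct (Hunb (L1 + L2)) as [l [Hl [x [Hx <-]]]].
    destruct (digit_cases x (Hpos x Hx)) as [_ [_ [E|E]]].
    - apply (lt_irrefl (low x)). assert (M := H1 x Hx E). lin (M, Hl) L2.
    - apply (lt_irrefl (low x)). assert (M := H2 x Hx E). lin (M, Hl) L1. }
  destruct Hdig as [dg Hdig].
  exists (fun l => exists x, x in_set X /\ digit x = dg /\ low x = l), (dg = 1 <-> c x0).
  split; [s1|]. split; [exact Hdig|].
  intros l [x [Hx [Ed El]]].
  (* The colours of the sums [x + y] reveal [d l] only at the places [top y]. These are unbounded,
     so by stability they determine the limit. *)
  assert (Happ : forall L, exists t, L < t /\ (d l t <-> (dg = 1 <-> c x0))).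
  { intros L. destruct (Hunb (L + top x)) as [ly [Hly [y [Hy Ely]]]]. rewrite <- Ely in Hly.
    exists (top y). split.
    - assert (M := low_le_top y (Hpos y Hy)). lin (Hly, M) (top x).
    - assert (Hap : top x < low y) by lin Hly L.
      assert (Hlow : low x < low y)
        by exact (le_lt_trans _ _ _ (low_le_top x (Hpos x Hx)) Hap).
      assert (Hxy : x < y).
      { apply not_le; intros M. apply top_mono in M.
        assert (M' := low_le_top y (Hpos y Hy)).
        exact (lt_irrefl _ (lt_le_trans _ _ _ Hap (le_trans _ _ _ M' M))). }
      assert (S : c (x + y) <-> c x0).
      { apply HX; [right; exists x, y; auto|left; exact Hx0]. }
      destruct (low_add_lt x y (Hpos x Hx) (Hpos y Hy) Hlow) as [E1 E2].
      unfold c at 1 in S. rewrite E1, E2, (top_add_apart x y (Hpos y Hy) Hap), Ed, El in S.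
      tauto. }
  destruct (Hst l) as [[m Hm]|[m Hm]]; exists m; intros t Ht; assert (M := Hm t Ht);
    destruct (Happ m) as [u [Hu Hiff]]; assert (M' := Hm u Hu); tauto.
Qed.

(** The comparison [p s < p t] is stable, and on [A] its limit always has the same direction. The
    values of [p] on [A] form a bounded Sigma_1 set, so an extreme one is attained; a sufficiently
    late element of [A] goes beyond it. *)
Lemma no_bounded_strict_limits (p : num -> num) b : T1 (fun e => p (e 0%nat)) ->
  (forall s, p s <= b) ->
  (forall s, eventually (fun t => p s < p t) \/ eventually (fun t => p t < p s)) -> False.
Proof.
  intros Hp Hb Hs.
  destruct (limit_homogeneous (fun s t => p s < p t)) as [A [i [HA [Hinf Hi]]]]; [d1| |].
  { intros s. destruct (Hs s) as [H|[m H]]; [left; exact H|right]. exists m. intros t Ht.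
    apply not_lt, lt_le_incl, H, Ht. }
  destruct (Hinf 0) as [a0 [_ Ha0]].
  destruct (classic i) as [I|I].
  - destruct (S1_greatest (fun v => exists a, A a /\ v = p a) (p a0) b) as [v [[a [Ha ->]] Hv]];
      [s1|intros v [a [_ ->]]; apply Hb|eauto|].
    destruct (Hi a Ha) as [m Hm]. destruct (Hinf m) as [a' [Ha'm Ha']].
    apply (lt_irrefl (p a)), (lt_le_trans _ (p a')); [apply Hm; auto|apply Hv; eauto].
  - destruct (S1_least (fun v => exists a, A a /\ v = p a) (p a0)) as [v [[a [Ha ->]] Hv]];
      [s1|eauto|].
    destruct (Hi a Ha) as [m Hm]. destruct (Hs a) as [[k Hk]|[k Hk]].
    + assert (H1 : m < m + k + 1) by lin (le_0_l k) 0.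
      assert (H2 : k < m + k + 1) by lin (le_0_l m) 0.
      apply I, (Hm _ H1), (Hk _ H2).
    + destruct (Hinf k) as [a' [Ha'k Ha']]. apply (Hv (p a')); eauto.
Qed.

End Combinatorics.

(** * An infinite pigeonhole principle *)

Section Digits.
Context {K : RCA0_model}.
Open Scope model_scope.
Notation env := (nat -> num).
Add Ring num_ring : num_semi_ring.
Variable b : num.
Hypothesis b_pos : 0 < b.

Definition dg p w := rem (quo p (pw b w)) b.

Lemma T1_dg : T1 (fun e => dg (e 0%nat) (e 1%nat)).
Proof. unfold dg; t1. Qed.
Hint Resolve T1_dg : rec.

Lemma dg_lt p w : dg p w < b.
Proof. apply rem_lt, b_pos. Qed.

(** Moves the digit [i] from position [w] to position [0]. *)
Definition to_front p w i := quo p (pw b (w + 1)) * pw b (w + 1) + rem p (pw b w) * b + i.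

Lemma T1_to_front : T1 (fun e => to_front (e 0%nat) (e 1%nat) (e 2%nat)).
Proof. unfold to_front; t1. Qed.

Lemma quo_to_front p w i v : i < b -> w < v ->
  quo (to_front p w i) (pw b v) = quo p (pw b v).
Proof.
  intros Hi Hv. apply lt_iff in Hv as [z ->].
  replace (w + z + 1) with (w + 1 + z) by ring. rewrite pw_add.
  rewrite <- !(quo_quo _ _ _ (pw_pos b _ b_pos) (pw_pos b _ b_pos)). f_equal.
  apply (quo_unique _ _ _ (rem p (pw b w) * b + i)); [unfold to_front; ring|].
  rewrite pw_succ.
  assert (L := le_mul _ _ _ _ (lt_le _ _ (rem_lt p (pw b w) (pw_pos b w b_pos))) (le_refl b)).
  lin (L, Hi) 0.
Qed.

Lemma dg_to_front_above p w i v : i < b -> w < v -> dg (to_front p w i) v = dg p v.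
Proof. intros Hi Hv. unfold dg. rewrite quo_to_front; auto. Qed.

Lemma dg_to_front_0 p w i : i < b -> dg (to_front p w i) 0 = i.
Proof.
  intros Hi. unfold dg. rewrite pw_0, quo_1.
  apply (rem_unique _ _ (quo p (pw b (w + 1)) * pw b w + rem p (pw b w))); [|exact Hi].
  unfold to_front. rewrite pw_succ. ring.
Qed.

Lemma dg_low x y v w : v < w -> dg (x + pw b w * y) v = dg x v.
Proof.
  intros H. apply lt_iff in H as [z ->].
  replace (x + pw b (v + z + 1) * y) with (x + pw b v * (b * (pw b z * y)))
    by (rewrite pw_succ, pw_add; ring).
  unfold dg. rewrite quo_add_mul by apply pw_pos, b_pos. apply rem_add_mul, b_pos.
Qed.

Lemma dg_to_front_below p w i v : i < b -> v < w -> dg (to_front p w i) (v + 1) = dg p v.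
Proof.
  intros Hi Hv.
  transitivity (dg (rem p (pw b w)) v).
  - transitivity (dg (rem p (pw b w) + pw b w * quo p (pw b (w + 1))) v); [|apply dg_low, Hv].
    unfold dg at 1. rewrite pw_succ, (mul_comm (pw b v)), <- quo_quo by auto using pw_pos.
    unfold dg. do 2 f_equal. apply (quo_unique _ _ _ i); [|exact Hi].
    unfold to_front. rewrite pw_succ. ring.
  - rewrite (quo_rem p (pw b w)) at 2. rewrite add_comm, (mul_comm (quo _ _)).
    symmetry; apply dg_low, Hv.
Qed.

(** The new position [u] shows the old digit at [s]. This position map is a cycle on [0, ..., w] and
    the identity above, hence injective, as [permutation_to_front] needs. *)
Lemma dg_to_front p w i u : i < b -> w < b -> u < b -> dg p w = i ->
  exists s, s < b /\ dg (to_front p w i) u = dg p s /\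
    ((u = 0 /\ s = w) \/ (s < w /\ u = s + 1) \/ (w < u /\ s = u)).
Proof.
  intros Hi Hw Hu Hp. destruct (le_or_lt u w) as [L|L].
  - destruct (zero_or_succ u) as [->|[v ->]].
    + exists w. rewrite dg_to_front_0 by assumption. auto.
    + assert (Hv : v < w) by lin L 0. exists v. split; [exact (lt_trans _ _ _ Hv Hw)|].
      rewrite dg_to_front_below by assumption. auto 6.
  - exists u. rewrite dg_to_front_above by assumption. auto 6.
Qed.

Definition permutation p := p < pw b b /\
  (forall i, i < b -> exists w, w < b /\ dg p w = i) /\
  (forall v, v < b -> forall w, w < b -> dg p v = dg p w -> v = w).

Lemma permutation_to_front p w i : i < b -> w < b -> dg p w = i ->
  permutation p -> permutation (to_front p w i).
Proof.
  intros Hi Hw Hp [Hlt [Hsurj Hinj]]. split; [|split].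
  - apply quo_eq_0; [apply pw_pos, b_pos|].
    rewrite quo_to_front by assumption. apply quo_small, Hlt.
  - intros j Hj. destruct (Hsurj j Hj) as [v [Hv Ev]].
    destruct (lt_trichotomy v w) as [L|[->|L]].
    + exists (v + 1). split; [assert (M := lt_le _ _ L); exact (le_lt_trans _ _ _ M Hw)|].
      rewrite dg_to_front_below; assumption.
    + exists 0. split; [exact b_pos|]. rewrite dg_to_front_0 by assumption. congruence.
    + exists v. split; [exact Hv|]. rewrite dg_to_front_above; assumption.
  - intros u Hu v Hv E.
    destruct (dg_to_front p w i u Hi Hw Hu Hp) as [s [Hs [Es Cs]]].
    destruct (dg_to_front p w i v Hi Hw Hv Hp) as [t [Ht [Et Ct]]].
    assert (st : s = t) by (apply Hinj; congruence). subst t. clear E Es Et.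
    destruct Cs as [[-> ->]|[[L ->]|[L ->]]], Ct as [[-> E]|[[M E]|[M E]]]; subst;
      try reflexivity; try (destruct (lt_irrefl _ L)); try (destruct (lt_irrefl _ M));
      try congruence; try (destruct (lt_irrefl _ (lt_trans _ _ _ L M)));
      try (destruct (lt_irrefl _ (lt_trans _ _ _ M L))).
Qed.

Lemma permutation_exists : exists p, permutation p.
Proof.
  assert (H : forall k, exists q, k <= b -> q < pw b k /\ forall w, w < k -> dg q w = w).
  { induct.
    - exists 0; intros _; split; [rewrite pw_0; apply lt_0_1|].
      intros w Hw; destruct (nlt_0_r _ Hw).
    - intros k [q Hq]. exists (q + pw b k * k). intros Hk.
      destruct Hq as [Hlt Hq]; [lin Hk 1|]. split.
      + rewrite pw_succ. assert (Hk' : k + 1 <= b) by exact Hk.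
        assert (L := le_mul _ _ _ _ (le_refl (pw b k)) Hk'). lin (L, Hlt) 0.
      + intros w Hw. apply lt_succ_r in Hw as [Hw| ->].
        * rewrite dg_low by assumption. apply Hq, Hw.
        * unfold dg. rewrite quo_add_mul by apply pw_pos, b_pos.
          rewrite quo_small by assumption. rewrite add_0_l. apply rem_small. lin Hk 0. }
  destruct (H b) as [q Hq]. destruct (Hq (le_refl b)) as [Hlt Hdg].
  exists q. split; [exact Hlt|split].
  - intros i Hi; exists i; auto.
  - intros v Hv w Hw E. rewrite <- (Hdg v Hv), <- (Hdg w Hw); exact E.
Qed.

(** The alternative [b <= w] stops the search at [b] when [i] is not among the digits. *)
Definition position p i := mu (fun w => dg p w = i \/ b <= w).

Lemma T1_position : T1 (fun e => position (e 0%nat) (e 1%nat)).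
Proof.
  apply (T1_mu (fun e w => dg (e 0%nat) w = e 1%nat \/ b <= w)); [d1|].
  intros e; exists b; right; apply le_refl.
Qed.

Lemma position_spec p i : permutation p -> i < b -> position p i < b /\ dg p (position p i) = i.
Proof.
  intros [_ [H _]] Hi. destruct (H i Hi) as [w [Hw Ew]].
  destruct (mu_spec (fun w => dg p w = i \/ b <= w)) as [H1 H2]; [s1|eauto|].
  fold (position p i) in H1, H2.
  assert (L : position p i < b).
  { apply not_le; intros L. apply (H2 w); [exact (lt_le_trans _ _ _ Hw L)|auto]. }
  split; [exact L|]. destruct H1 as [H1|H1]; [exact H1|].
  apply not_lt in H1; contradiction.
Qed.

End Digits.

#[export] Hint Resolve T1_dg T1_to_front T1_position : rec.

Section Pigeonhole.
Context {K : RCA0_model}.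
Open Scope model_scope.
Notation env := (nat -> num).
Add Ring num_ring : num_semi_ring.
Hypothesis HT : Hindman2.

(** The base-[b] numbers [P t] list the colours below [b] by their last occurrence
    before [t], the most recent one at position [0]. If every colour dies out, the
    leading digits of [P t] are stable up to the final position of each colour, so
    by [no_bounded_strict_limits] some [P s] agrees with all the stable prefixes.
    But then its own last digit also occurs in a stable prefix. *)
Lemma infinite_pigeonhole (f : num -> num) b : T1 (fun e => f (e 0%nat)) ->
  (forall t, f t < b) -> exists i, ~ eventually (fun t => f t <> i).
Proof.
  intros Hf Hb. apply NNPP; intros N.
  assert (Hev : forall i, eventually (fun t => f t <> i)).
  { intros i; apply NNPP; intros H; apply N; exists i; exact H. }
  clear N.
  assert (b_pos : 0 < b) by exact (le_lt_trans _ _ _ (le_0_l (f 0)) (Hb 0)).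
  destruct (permutation_exists b b_pos) as [p0 Hp0].
  assert (T := T1_dg b). assert (T' := T1_position b). assert (T'' := T1_to_front b).
  destruct (primitive_recursion0 p0 (fun t p => to_front b p (position b p (f t)) (f t)))
    as [P [HP [P0 PS]]]; [t1|].
  assert (Hperm : forall t, permutation b (P t)).
  { unfold permutation. induct.
    - rewrite P0. exact Hp0.
    - intros t IH. rewrite PS.
      destruct (position_spec b (P t) (f t) IH (Hb t)).
      apply permutation_to_front; auto. }
  assert (Hs : exists s, ~ eventually (fun t => P s < P t) /\ ~ eventually (fun t => P t < P s)).
  { apply NNPP; intros N.
    apply (no_bounded_strict_limits HT P (pw b b) HP).
    - intros s; apply lt_le_incl, (proj1 (Hperm s)).
    - intros s; apply NNPP; intros N'. apply N; exists s; tauto. }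
  destruct Hs as [s [Hs1 Hs2]].
  set (i := dg b (P s) 0). assert (Hi : i < b) by (apply dg_lt, b_pos).
  destruct (Hev i) as [m Hm].
  (* After [m] the colour [i] is never moved to the front, so its position can only grow. The
     greatest position that it ever takes is thus final. *)
  destruct (S1_greatest (fun w => w < b /\ exists t, m < t /\ dg b (P t) w = i)
              (position b (P (m + 1)) i) b) as [w [[Hw [t0 [Ht0 Ew]]] Hmax]]; [s1| | |].
  { intros w [Hw _]; apply lt_le_incl, Hw. }
  { destruct (position_spec b (P (m + 1)) i (Hperm _) Hi) as [H1 H2].
    split; [exact H1|]. exists (m + 1); split; [apply le_refl|exact H2]. }
  assert (Htouch : forall t, m < t -> dg b (P t) w = i -> position b (P t) (f t) < w).
  { intros t Ht E. destruct (position_spec b (P t) (f t) (Hperm t) (Hb t)) as [H1 H2].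
    destruct (lt_trichotomy (position b (P t) (f t)) w) as [L|[L|L]]; [exact L| |].
    - destruct (Hm t Ht). rewrite <- H2, L; exact E.
    - exfalso. apply (lt_irrefl w), (lt_le_trans _ (w + 1)); [apply le_refl|].
      apply Hmax. split; [exact (le_lt_trans _ _ _ (lt_le _ _ L) H1)|].
      exists (t + 1). split; [apply (lt_trans _ _ _ Ht), le_refl|].
      rewrite PS, dg_to_front_below by auto. exact E. }
  assert (Hstab : forall k, dg b (P (t0 + k)) w = i /\ quo (P (t0 + k)) (pw b w) = quo (P t0) (pw b w)).
  { induct; [rewrite add_0_r; auto|].
    intros k [E1 E2]. rewrite add_assoc, PS.
    assert (L : position b (P (t0 + k)) (f (t0 + k)) < w).
    { apply Htouch; [|exact E1]. apply (lt_le_trans _ _ _ Ht0). lin (le_0_l k) 0. }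
    rewrite dg_to_front_above, quo_to_front by auto. auto. }
  assert (Hquo : quo (P s) (pw b w) = quo (P t0) (pw b w)).
  { assert (Hlate : forall t, t0 < t -> quo (P t) (pw b w) = quo (P t0) (pw b w)).
    { intros t Ht. apply lt_iff in Ht as [k ->]. rewrite <- add_assoc. apply Hstab. }
    destruct (lt_trichotomy (quo (P s) (pw b w)) (quo (P t0) (pw b w))) as [L|[L|L]];
      [exfalso|exact L|exfalso].
    - apply Hs1. exists t0. intros t Ht. rewrite <- (Hlate t Ht) in L.
      exact (quo_lt_mono _ _ _ (pw_pos b w b_pos) L).
    - apply Hs2. exists t0. intros t Ht. rewrite <- (Hlate t Ht) in L.
      exact (quo_lt_mono _ _ _ (pw_pos b w b_pos) L). }
  assert (Ew0 : w = 0).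
  { destruct (Hperm s) as [_ [_ Hinj]]. apply Hinj; [exact Hw|exact b_pos|].
    fold i. rewrite <- Ew. unfold dg. rewrite Hquo; reflexivity. }
  (* The colour moved to the front at [t0] must come from a position below [w], and there is none
     below 0. *)
  apply (nlt_0_r (position b (P t0) (f t0))). rewrite <- Ew0. apply Htouch; assumption.
Qed.

(** * Thinning to a homogeneous set *)

(** Membership in [A] is only enumerable, so the next element cannot be searched for directly.
    [bnd z] bounds some element above [z] together with its witness, and [next z] is the least
    element certified below this bound; elements of [A] may be skipped. *)
Lemma increasing_enumeration (A : num -> Prop) : S1 (fun e => A (e 0%nat)) -> infinite_in A ->
  exists g, T1 (fun e => g (e 0%nat)) /\ (forall n, A (g n)) /\ (forall n, g n < g (n + 1)).
Proof.
  intros [Q [HQ HA]] Hinf.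
  pose (R a x := Q (scons x (fun _ => a))).
  assert (HR : D1 (fun e => R (e 0%nat) (e 1%nat))).
  { apply D1_D0.
    refine (D0_ext _ _ (D0_inst Q (fun n => match n with 0%nat => inl 1%nat | _ => inl 0%nat end) HQ) _).
    intros e; unfold R; replace (assign _ e) with (scons (e 1%nat) (fun _ => e 0%nat)); [reflexivity|].
    apply functional_extensionality; intros [|n]; reflexivity. }
  assert (HAR : forall a, A a <-> exists x, R a x) by (intros a; apply (HA (fun _ => a))).
  pose (bnd z := mu (fun c => exists a, a < c /\ (z < a /\ exists x, x < c /\ R a x))).
  assert (Hbnd : forall z, exists c, exists a, a < c /\ (z < a /\ exists x, x < c /\ R a x)).
  { intros z. destruct (Hinf z) as [a [Hza Ha]]. apply HAR in Ha as [x Hx].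
    exists (a + x + 1), a. split; [lin (le_0_l x) 0|]. split; [exact Hza|].
    exists x; split; [lin (le_0_l a) 0|exact Hx]. }
  assert (T1_bnd : T1 (fun e => bnd (e 0%nat))).
  { apply (T1_mu (fun e c => exists a, a < c /\ (e 0%nat < a /\ exists x, x < c /\ R a x))); [d1|].
    intros e; apply Hbnd. }
  pose (next z := mu (fun a => z < a /\ exists x, x < bnd z /\ R a x)).
  assert (Hnext : forall z, exists a, z < a /\ exists x, x < bnd z /\ R a x).
  { intros z.
    destruct (mu_spec (fun c => exists a, a < c /\ (z < a /\ exists x, x < c /\ R a x)))
      as [[a [_ H]] _]; [s1|apply Hbnd|]. exists a; exact H. }
  assert (T1_next : T1 (fun e => next (e 0%nat))).
  { apply (T1_mu (fun e a => e 0%nat < a /\ exists x, x < bnd (e 0%nat) /\ R a x)); [d1|].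
    intros e; apply Hnext. }
  assert (next_spec : forall z, z < next z /\ A (next z)).
  { intros z. destruct (mu_spec (fun a => z < a /\ exists x, x < bnd z /\ R a x))
      as [[H [x [_ Hx]]] _]; [s1|apply Hnext|].
    split; [exact H|]. apply HAR; exists x; exact Hx. }
  destruct (primitive_recursion0 (next 0) (fun _ y => next y)) as [g [Hg [g0 gS]]]; [t1|].
  exists g; split; [exact Hg|split].
  - intros n. destruct (zero_or_succ n) as [->|[k ->]]; [rewrite g0|rewrite gS]; apply next_spec.
  - intros n. rewrite gS. apply next_spec.
Qed.

(** Greedy thinning: a member of the enumeration is accepted if it has colour [i] with every number
    accepted before. If acceptance stopped at [L], each later member would be refused by some
    accepted [h <= L]. By the pigeonhole principle one such [h] refuses infinitely often, against
    its limit colour. *)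
Lemma homogeneous_set (d : num -> num -> Prop) :
  D1 (fun e => d (e 0%nat) (e 1%nat)) -> stable_rel d ->
  exists H (i : Prop), infinite_in (fun x => x in_set H) /\
    forall x y, x in_set H -> y in_set H -> x < y -> (d x y <-> i).
Proof.
  intros Hd Hst.
  destruct (limit_homogeneous HT d Hd Hst) as [A [i [HA [Hinf Hlim]]]].
  pose (d' x y := d x y <-> i).
  assert (Hd' : D1 (fun e => d' (e 0%nat) (e 1%nat))).
  (* [i] is one fixed proposition, so [d'] is either [d] or its complement. *)
  { unfold d'. destruct (classic i).
    - apply (D1_ext _ _ Hd); intros e; tauto.
    - apply (D1_ext _ _ (D1_not _ Hd)); intros e; tauto. }
  destruct (increasing_enumeration A HA Hinf) as [g [Hg [gA gS]]].
  assert (g_ge : forall n, n <= g n).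
  { induct; [apply le_0_l|]. intros n IH. assert (L := gS n). lin (IH, L) 0. }
  assert (Hbeta := T1_beta).
  (* By [g_ge] a preimage of [n] is at most [n], so the range of [g] is Delta_1. *)
  pose (Z := fun n => exists k, k < n + 1 /\ g k = n).
  assert (HZ : D1 (fun e => Z (e 0%nat))) by (unfold Z; d1).
  pose (Phi := fun (_ c m n : num) =>
     ite (Z n /\ forall h, h < n -> beta c m h = 1 -> d' h n) 1 0).
  destruct (course_of_values Phi) as [G [HG HGs]].
  { unfold Phi; t1. }
  { intros p c m c' m' n E. unfold Phi. f_equal. apply propositional_extensionality.
    split; intros [H1 H2]; split; auto; intros h Hh Eh; apply H2; auto;
      [rewrite E|rewrite <- E]; auto. }
  assert (HGn : forall n, G 0 n = 1 <-> (Z n /\ forall h, h < n -> G 0 h = 1 -> d' h n)).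
  { intros n. destruct (HGs 0 n) as [c [m [L ->]]]. unfold Phi.
    assert (N : 0 <> 1) by exact (lt_neq _ _ lt_0_1).
    assert (E : (forall h, h < n -> beta c m h = 1 -> d' h n)
             <-> (forall h, h < n -> G 0 h = 1 -> d' h n)).
    { split; intros H h Hh Eh; apply H; auto; [rewrite L|rewrite <- L]; auto. }
    unfold ite; destruct excluded_middle_informative as [P|P]; rewrite E in P; tauto. }
  destruct (D1_comprehension (fun n => G 0 n = 1)) as [H HH]; [s1|s1|].
  exists H, i. split.
  - intros L. apply NNPP; intros N.
    assert (HL : forall x, x in_set H -> x <= L).
    { intros x Hx. apply not_lt; intros Lx. apply N; eauto. }
    assert (Hfail : forall n, exists h, h <= L /\ (h in_set H /\ ~ d' h (g (n + L + 1)))).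
    (* The shift of the index by [L + 1] lifts the candidate above [L], hence out of [H]. *)
    { intros n. set (a := g (n + L + 1)).
      assert (Ha : L < a) by (assert (M := g_ge (n + L + 1)); fold a in M; lin M n).
      assert (Na : ~ G 0 a = 1).
      { intros E. apply HH in E. apply HL in E. exact (lt_irrefl _ (lt_le_trans _ _ _ Ha E)). }
      apply NNPP; intros N'. apply Na, HGn. split.
      - exists (n + L + 1). split; [apply g_ge|reflexivity].
      - intros h _ Eh. apply HH in Eh. apply NNPP; intros Nh. apply N'. exists h; auto. }
    pose (f n := mu (fun h => h in_set H /\ ~ d' h (g (n + L + 1)))).
    assert (Hf : forall n, f n in_set H /\ ~ d' (f n) (g (n + L + 1))).
    { intros n. apply (mu_spec (fun h => h in_set H /\ ~ d' h (g (n + L + 1)))); [s1|].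
      destruct (Hfail n) as [h [_ Hh]]; eauto. }
    destruct (infinite_pigeonhole f (L + 1)) as [h Hh].
    { apply (T1_mu (fun e h => h in_set H /\ ~ d' h (g (e 0%nat + L + 1)))); [d1|].
      intros e. destruct (Hfail (e 0%nat)) as [h [_ Hh]]; eauto. }
    { intros n; apply HL, Hf. }
    apply Hh. destruct (classic (h in_set H)) as [HhH|HhH].
    + assert (HhA : A h).
      { apply HH in HhH. apply HGn in HhH as [[k [_ <-]] _]. apply gA. }
      destruct (Hlim h HhA) as [m Hm]. exists m. intros t Ht <-.
      apply (proj2 (Hf t)). apply Hm.
      assert (M := g_ge (t + L + 1)). lin (Ht, M) (L + 1).
    + exists 0. intros t _ <-. apply HhH, Hf.
  - intros x y Hx Hy Hxy. apply HH in Hx, Hy. apply HGn in Hy as [_ Hy]. exact (Hy x Hxy Hx).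
Qed.

End Pigeonhole.

(** * Evaluation of the two principles in a model *)

Section Evaluation.
Context {K : RCA0_model}.
Open Scope model_scope.
Notation env := (nat -> num).
Add Ring num_ring : num_semi_ring.

Definition pr x y := (x + y) * (x + y) + x.

(** [pr x y] lies between the squares of [x + y] and [x + y + 1], the latter excluded, so it
    determines the sum and then [x]. *)
Lemma pr_inj x y x' y' : pr x y = pr x' y' -> x = x' /\ y = y'.
Proof.
  assert (H : forall x y x' y', pr x y = pr x' y' -> ~ x + y < x' + y').
  { clear. intros x y x' y' E L. apply (lt_irrefl (pr x y)). rewrite E at 2. unfold pr.
    assert (M := le_mul _ _ _ _ (lt_le _ _ L) (lt_le _ _ L)).
    lin M (x + y + y + x'). }
  intros E. assert (S : x + y = x' + y').
  { destruct (lt_trichotomy (x + y) (x' + y')) as [L|[L|L]]; [|exact L|].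
    - destruct (H _ _ _ _ E L).
    - destruct (H _ _ _ _ (eq_sym E) L). }
  unfold pr in E. rewrite S in E. apply add_cancel_l in E. subst x'. split; [reflexivity|].
  exact (add_cancel_l _ _ _ S).
Qed.

Lemma le_pr_l x y : x <= pr x y.
Proof. unfold pr. lin (le_0_l ((x + y) * (x + y))) 0. Qed.

Lemma teval_tshift (e : env) x t : teval model (scons x e) (tshift t) = teval model e t.
Proof. unfold tshift. rewrite teval_subst. reflexivity. Qed.

Lemma teval_pair (e : env) s t :
  teval model e (pair s t) = pr (teval model e s) (teval model e t).
Proof. reflexivity. Qed.

Ltac sat_simpl := repeat first
  [ rewrite sat_and | rewrite sat_or | rewrite sat_exn | rewrite sat_exs
  | progress cbn [sat] | progress setoid_rewrite sat_and | progress setoid_rewrite sat_exn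
  | rewrite teval_pair | progress setoid_rewrite teval_pair
  | rewrite teval_tshift | progress setoid_rewrite teval_tshift ].

Lemma sat_coloring (e : env) E domain k C :
  sat model e E (coloring domain k C) <->
  (forall z, z in_set E C -> exists x i,
     sat model (scons i (scons x (scons z e))) E (domain (tvar 1)) /\
     i < teval model (scons i (scons x (scons z e))) (Defs.num k) /\ z = pr x i) /\
  (forall x, sat model (scons x e) E (domain (tvar 0)) -> exists i,
     i < teval model (scons i (scons x e)) (Defs.num k) /\ pr x i in_set E C) /\
  (forall x i j, pr x i in_set E C /\ pr x j in_set E C -> i = j).
Proof. unfold coloring. sat_simpl. reflexivity. Qed.

Lemma sat_is_pair (e : env) E t :
  sat model e E (is_pair t) <-> exists x y, x < y /\ teval model e t = pr x y.
Proof. unfold is_pair. sat_simpl. reflexivity. Qed.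

Lemma sat_infinite (e : env) E X :
  sat model e E (infinite X) <-> infinite_in (fun x => x in_set E X).
Proof. unfold infinite. sat_simpl. reflexivity. Qed.

Lemma sat_same_color (e : env) E C s t :
  sat model e E (same_color C s t) <->
  exists i, pr (teval model e s) i in_set E C /\ pr (teval model e t) i in_set E C.
Proof. unfold same_color. sat_simpl. reflexivity. Qed.

Lemma sat_FS2 (e : env) E X t :
  sum_of_two (E X) (teval model e t) -> sat model e E (FS 2 X t).
Proof.
  intros H. unfold FS, FS_exactly, big_or, big_and. cbn [map seq fold_right Nat.iter Nat.sub].
  rewrite !sat_or. destruct H as [H|[x [y [Hx [Hy [L Et]]]]]]; [left|right; left].
  - sat_simpl. exists (teval model e t). cbn. repeat split; auto. ring.
  (* The outer quantifier binds [$1], which is the larger summand. *)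
  - sat_simpl. exists y, x. cbn. repeat split; auto. rewrite Et; ring.
Qed.

Lemma T1_pr : T1 (fun e => pr (e 0%nat) (e 1%nat)).
Proof. unfold pr; t1. Qed.

Lemma lt_2_cases i : i < 0 + 1 + 1 <-> i = 0 \/ i = 1.
Proof.
  rewrite add_0_l, lt_succ_r, lt_1_r. reflexivity.
Qed.

Lemma Hindman2_of_HT (e : env) E : sat model e E (HT 2 2) -> Hindman2.
Proof.
  intros H c Hc. assert (Hpr := T1_pr).
  (* Colour 1 stands for [c z]. The bound [z <= w], harmless by [le_pr_l], makes the predicate
     Delta_1. *)
  destruct (D1_comprehension (fun w => exists z, z <= w /\ (0 < z /\
     ((c z /\ w = pr z 1) \/ (~ c z /\ w = pr z 0))))) as [C HC]; [s1|s1|].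
  assert (HC1 : forall z i, pr z i in_set C <-> 0 < z /\ ((c z /\ i = 1) \/ (~ c z /\ i = 0))).
  { intros z i. rewrite HC. split.
    - intros [z' [_ [Hz [[Hcz Ei]|[Hcz Ei]]]]]; apply pr_inj in Ei as [-> ->]; auto.
    - intros [Hz [[Hcz ->]|[Hcz ->]]]; exists z; split; auto using le_pr_l. }
  cbn [sat HT] in H. specialize (H C). rewrite sat_exs in H. destruct H as [X H].
  - apply sat_coloring. cbn [scons teval Defs.num positive sat]. split; [|split].
    + intros z Hz. apply HC in Hz as [x [_ [Hx [[_ Ez]|[_ Ez]]]]]; [exists x, 1|exists x, 0];
        rewrite lt_2_cases; auto.
    + intros x Hx. destruct (classic (c x)); [exists 1|exists 0]; rewrite lt_2_cases, HC1; auto.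
    + intros x i j [Hi Hj]. apply HC1 in Hi as [_ Hi], Hj as [_ Hj].
      destruct Hi as [[? ->]|[? ->]], Hj as [[? ->]|[? ->]]; tauto.
  - rewrite !sat_and in H. destruct H as [Hpos [Hinf Hmono]].
    exists X. split; [exact Hpos|]. split; [apply sat_infinite in Hinf; exact Hinf|].
    intros u v Hu Hv. cbn [sat] in Hmono. specialize (Hmono u v).
    rewrite sat_and, sat_same_color in Hmono. cbn [scons teval] in Hmono.
    destruct Hmono as [i [Hi Hj]].
    + split; apply sat_FS2; assumption.
    + apply HC1 in Hi as [_ Hi], Hj as [_ Hj].
      assert (N : 0 <> 1) by exact (lt_neq _ _ lt_0_1).
      destruct Hi as [[? ->]|[? ->]], Hj as [[? E']|[? E']]; try tauto; congruence.
Qed.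

Lemma SRT22_of_Hindman2 (e : env) E : Hindman2 -> sat model e E SRT22.
Proof.
  intros HT. unfold SRT22. cbn [sat]. intros D H. rewrite sat_and in H.
  destruct H as [Hcol Hst]. apply sat_coloring in Hcol as [_ [Htot Hfun]].
  cbn [scons] in Htot, Hfun.
  assert (Htot2 : forall x y, x < y -> pr (pr x y) 0 in_set D \/ pr (pr x y) 1 in_set D).
  { intros x y L. destruct (Htot (pr x y)) as [i [Hi Hin]].
    - apply sat_is_pair. exists x, y; auto.
    - cbn [teval Defs.num] in Hi. apply lt_2_cases in Hi as [-> | ->]; auto. }
  assert (Hst2 : forall x, exists i m, forall s, x < s -> m < s -> pr (pr x s) i in_set D).
  { unfold stable in Hst. cbn [sat] in Hst. intros x. specialize (Hst x).
    rewrite sat_exn in Hst. destruct Hst as [i Hst]. rewrite sat_exn in Hst.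
    destruct Hst as [m Hst]. exists i, m. intros s Hx Hm. cbn [sat] in Hst.
    specialize (Hst s). rewrite sat_and in Hst. exact (Hst (conj Hm Hx)). }
  assert (Hpr := T1_pr).
  destruct (homogeneous_set HT (fun x y => pr (pr x y) 1 in_set D)) as [X [i [Hinf HX]]].
  - d1.
  - intros x. destruct (Hst2 x) as [i [m Hm]].
    (* The sum serves as one threshold for both conditions of [stable], [x < s] and [m < s]. *)
    assert (Hm' : forall s, x + m < s -> pr (pr x s) i in_set D).
    { intros s Hs. apply Hm; [lin Hs m|lin Hs x]. }
    destruct (classic (i = 1)) as [->|N].
    + left. exists (x + m). exact Hm'.
    + right. exists (x + m). intros s Hs H1. apply N.
      apply (Hfun (pr x s)); split; [apply Hm', Hs|exact H1].
  - apply sat_exs. exists X. apply sat_and. split; [apply sat_infinite; exact Hinf|].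
    cbn [sat]. intros x y x' y'. rewrite !sat_and. cbn [sat scons teval].
    intros [[L [Hx Hy]] [L' [Hx' Hy']]]. apply sat_same_color.
    cbn [scons teval]. rewrite !teval_pair. cbn [scons teval].
    assert (E1 := HX x y Hx Hy L). assert (E2 := HX x' y' Hx' Hy' L').
    assert (T := Htot2 x y L). assert (T' := Htot2 x' y' L').
    destruct (classic i) as [I|I].
    + exists 1. tauto.
    + exists 0. tauto.
Qed.

End Evaluation.

Theorem corollary2p5 : proves RCA0 (fimp (HT 2 2) SRT22).
Proof.
  apply completeness. intros M e E HM HHT.
  pose (K := {| model := M; model_axioms := HM; some_set := E 0 |}).
  exact (@SRT22_of_Hindman2 K e E (@Hindman2_of_HT K e E HHT)).
Qed.
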